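(* Let $2\le k\le n$, let $f$ be a radial measurable function on $\{y\in\mathbb R^n: |y|>1\}$, $f(y)=f_0(|y|)$, and put $f_1(s)=f_0(s)(s^2-1)^{(k-3)/2}$, $s>1$. Then for all $x\in\mathbb R^n$ with $|x|>1$ and all $\xi\in G^x_{n,k}$, $$(Q_-f)(x,\xi)=\Phi_-(t),\qquad \Phi_-(t)=\frac{\Gamma(k/2)}{\pi^{1/2}}\left(\frac{t^2-1}{2}\right)^{2-k}F_-(t),$$ where $t=2|x|-1>1$ and $$F_-(t)=\frac{2}{\Gamma((k-1)/2)}\int_1^t (t^2-s^2)^{(k-3)/2} f_1(s)\, s\,ds.$$ It is assumed that the integral defining $F_-(t)$ exists in the Lebesgue sense.
   Context: For $x\in\mathbb R^n\setminus\{0\}$, $G^x_{n,k}$ is the set of all $k$-dimensional linear subspaces of $\mathbb R^n$ containing $x$. $\sigma_{k-1}=2\pi^{k/2}/\Gamma(k/2)$ is the area of $\mathbb S^{k-1}$. For $|x|>1$ and $\xi\in G^x_{n,k}$ the exterior tangent spherical mean is $$(Q_-f)(x,\xi)=\frac{1}{\sigma_{k-1}}\int_{\mathbb S^{n-1}\cap\xi} f(x+(|x|-1)\theta)\,d\theta,$$ where $d\theta$ is the surface area measure on $\mathbb S^{n-1}\cap\xi$. *)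

(* Defs.v *)
From HB Require Import structures.
From mathcomp Require Import all_boot all_order all_algebra.
From mathcomp Require Import all_classical all_reals all_analysis.
From mathcomp Require Import measurable_realfun.

Set Implicit Arguments.
Unset Strict Implicit.
Unset Printing Implicit Defensive.
Import Order.TTheory GRing.Theory Num.Theory.
Import numFieldNormedType.Exports.

Local Open Scope classical_set_scope.
Local Open Scope ring_scope.

(* The canonical norm of MathComp-Analysis on 'rV[R]_n is the sup norm. *)
Definition enorm (R : realType) (n : nat) (v : 'rV[R]_n) : R :=
  Num.sqrt (\sum_i v ord0 i ^+ 2).

(* Borel sigma-algebra of R^n, generated by the coordinate functions. *)
Section borel_rV.
Context (R : realType) (n : nat).

Definition coord_rV (i : 'I_n) (v : 'rV[R]_n) : R := v ord0 i.

Let rV_set0 : g_sigma_preimage coord_rV set0.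
Proof. exact: sigma_algebra0. Qed.

Let rV_setC A : g_sigma_preimage coord_rV A -> g_sigma_preimage coord_rV (~` A).
Proof. exact: sigma_algebraC. Qed.

Let rV_bigcup (F : _^nat) : (forall i, g_sigma_preimage coord_rV (F i)) ->
  g_sigma_preimage coord_rV (\bigcup_i (F i)).
Proof. exact: sigma_algebra_bigcup. Qed.

Definition rV_display : measure_display. Proof. exact: default_measure_display. Qed.

HB.instance Definition _ := @isMeasurable.Build rV_display
  'rV[R]_n (g_sigma_preimage coord_rV) rV_set0 rV_setC rV_bigcup.

Lemma measurable_coord_rV (i : 'I_n) : measurable_fun setT (coord_rV i).
Proof.
move=> _ Y mY; rewrite setTI; apply: sub_sigma_algebra => /=.
rewrite -bigcup_seq/=; exists i => /=; first by rewrite mem_index_enum.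
by exists Y => //; rewrite setTI.
Qed.

Lemma measurable_fun_rV d (T : measurableType d) (D : set T) (f : T -> 'rV[R]_n) :
  (forall i, measurable_fun D (coord_rV i \o f)) -> measurable_fun D f.
Proof.
move=> mf mD; move: (mD); apply: (measurability (\big[setU/set0]_(i < n)
  preimage_set_system setT (coord_rV i) measurable)) => //.
move=> _ [B + <-]; rewrite -bigcup_seq => -[i _ [C mC <-]].
by rewrite setTI -comp_preimage; exact: mf.
Qed.

End borel_rV.

(* Lebesgue measure on the Borel sets of R^n, as an n-fold product measure. *)
Section lebesgue_rV.
Context (R : realType).

Definition cons_rV n (p : R * 'rV[R]_n) : 'rV[R]_n.+1 :=
  row_mx (p.1)%:M p.2.

Lemma coord_cons_rV0 n : coord_rV ord0 \o @cons_rV n = fst.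
Proof.
apply/funext => -[x v]; rewrite /coord_rV /cons_rV /= mxE.
by case: splitP => // j _; rewrite mxE (ord1 j) mulr1n.
Qed.

Lemma coord_cons_rVS n (i : 'I_n) :
  coord_rV (lift ord0 i) \o @cons_rV n = coord_rV i \o snd.
Proof.
apply/funext => -[x v]; rewrite /coord_rV /cons_rV /= mxE.
case: splitP => [j|j]; first by rewrite (ord1 j).
by rewrite /= /bump leq0n !add1n => -[ij]; congr (v _ _); exact/val_inj.
Qed.

Lemma measurable_cons_rV n : measurable_fun setT (@cons_rV n).
Proof.
apply: measurable_fun_rV => i; have [j ->|->] := unliftP ord0 i.
  rewrite coord_cons_rVS; apply: measurableT_comp => //.
  exact: measurable_coord_rV.
by rewrite coord_cons_rV0.
Qed.

Section step.
Context (n : nat) (m : {sigma_finite_measure set 'rV[R]_n -> \bar R}).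

Definition lebesgue_rVS : set 'rV[R]_n.+1 -> \bar R :=
  pushforward (lebesgue_measure \x m)%E (@cons_rV n).

Let preim A : measurable A -> measurable (@cons_rV n @^-1` A).
Proof. by move=> mA; rewrite -[X in measurable X]setTI; exact: measurable_cons_rV. Qed.

Let lebesgue_rVS0 : lebesgue_rVS set0 = 0%E.
Proof. by rewrite /lebesgue_rVS /pushforward preimage_set0 measure0. Qed.

Let lebesgue_rVS_ge0 A : (0 <= lebesgue_rVS A)%E.
Proof. by rewrite /lebesgue_rVS /pushforward; exact: measure_ge0. Qed.

Let lebesgue_rVS_additive : semi_sigma_additive lebesgue_rVS.
Proof.
move=> F mF tF mUF; rewrite /lebesgue_rVS /pushforward preimage_bigcup.
apply: measure_semi_sigma_additive.
- by move=> k; exact: preim.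
- apply/trivIsetP => /= i j _ _ ij; rewrite -preimage_setI.
  by move/trivIsetP : tF => /(_ _ _ _ _ ij) ->//; rewrite preimage_set0.
- by rewrite -preimage_bigcup; exact: preim.
Qed.

HB.instance Definition _ := isMeasure.Build _ _ _ lebesgue_rVS
  lebesgue_rVS0 lebesgue_rVS_ge0 lebesgue_rVS_additive.

Let lebesgue_rVS_sigma_finite : sigma_finite setT lebesgue_rVS.
Proof.
have /sigma_finiteP[F [TF ndF Foo]] := sigma_finiteT (@lebesgue_measure R).
have /sigma_finiteP[G [TG ndG Goo]] := sigma_finiteT m.
pose t (v : 'rV[R]_n.+1) : 'rV[R]_n := \row_i v ord0 (lift ord0 i).
have mt : measurable_fun setT t.
  apply: measurable_fun_rV => i.
  rewrite (_ : _ \o _ = coord_rV (lift ord0 i)); first exact: measurable_coord_rV.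
  by apply/funext => v; rewrite /coord_rV /= mxE.
pose H k := coord_rV ord0 @^-1` F k `&` t @^-1` G k.
have HE k : @cons_rV n @^-1` H k = F k `*` G k.
  have c0 (p : R * 'rV[R]_n) : coord_rV ord0 (cons_rV p) = p.1.
    by rewrite -[LHS]/((coord_rV ord0 \o @cons_rV n) p) coord_cons_rV0.
  have tE (p : R * 'rV[R]_n) : t (cons_rV p) = p.2.
    apply/rowP => i; rewrite mxE.
    by rewrite -[LHS]/((coord_rV (lift ord0 i) \o @cons_rV n) p) coord_cons_rVS.
  by apply/seteqP; split=> p; rewrite /H /preimage /setX /= c0 tE.
exists H => [|k].
  apply/esym/seteqP; split=> // v _.
  have [i _ Fi] : (\bigcup_i F i) (coord_rV ord0 v) by rewrite -TF.
  have [j _ Gj] : (\bigcup_i G i) (t v) by rewrite -TG.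
  exists (maxn i j) => //; split.
    have /subsetPset := ndF _ _ (leq_maxl i j); exact.
  have /subsetPset := ndG _ _ (leq_maxr i j); exact.
have [? ?] := Foo k; have [? ?] := Goo k; split.
  apply: measurableI; rewrite -[X in measurable X]setTI.
    exact: measurable_coord_rV.
  exact: mt.
rewrite /lebesgue_rVS /pushforward HE.
by rewrite product_measure1E// lte_mul_pinfty// ge0_fin_numE.
Qed.

HB.instance Definition _ := Measure_isSigmaFinite.Build _ _ _ lebesgue_rVS
  lebesgue_rVS_sigma_finite.

End step.

Fixpoint lebesgue_rV (n : nat) : {sigma_finite_measure set 'rV[R]_n -> \bar R} :=
  match n with
  | 0 => \d_ (0 : 'rV[R]_0)
  | n.+1 => lebesgue_rVS (lebesgue_rV n)
  end.

End lebesgue_rV.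

(* Completion of Lebesgue measure on R^n, and Lebesgue measurability. *)
Section lebesgue_completed.
Context (R : realType) (n : nat).

Definition completed_rV := caratheodory_type ((lebesgue_rV R n)^*)%mu.

HB.instance Definition _ := Measurable.on completed_rV.

Definition lebesgue_measurable_fun (D : set 'rV[R]_n) (f : 'rV[R]_n -> R) :=
  measurable_fun (D : set completed_rV) (f : completed_rV -> R).

End lebesgue_completed.

Section orthonormal_frame.
Context (R : realType) (n : nat).

(* An orthonormal basis of xi, as the rows of a matrix. *)
Definition orthonormal_frame (xi : {vspace 'rV[R]_n}) : 'M[R]_(\dim xi, n) :=
  xget 0 [set B : 'M[R]_(\dim xi, n) |
          B *m B^T = 1%:M /\ forall i, row i B \in xi].

Let gram_schmidt k (U : {vspace 'rV[R]_n}) : \dim U = k ->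
  exists B : 'M[R]_(k, n), B *m B^T = 1%:M /\ forall i, row i B \in U.
Proof.
elim: k U => [|k IH] U dU.
  by exists 0; split=> [|[]//]; rewrite [LHS]flatmx0 [RHS]flatmx0.
have U0 : U != 0%VS by rewrite -dimv_eq0 dU.
pose v := vpick U.
have v0 : v != 0 by rewrite vpick0.
have vv : 0 < (v *m v^T) ord0 ord0.
  rewrite lt_neqAle; apply/andP; split; last first.
    by rewrite mxE sumr_ge0// => i _; rewrite mxE -expr2 sqr_ge0.
  apply: contra v0 => /eqP/esym; rewrite mxE => /eqP.
  rewrite psumr_eq0 => [/allP h|i _]; last by rewrite mxE -expr2 sqr_ge0.
  apply/eqP/rowP => i; have := h i (mem_index_enum i).
  by rewrite !mxE -expr2 sqrf_eq0 => /eqP.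
pose u := (Num.sqrt ((v *m v^T) ord0 ord0))^-1 *: v.
have uu : u *m u^T = 1%:M.
  rewrite /u; set d := (v *m v^T) ord0 ord0 in vv *.
  have dE : v *m v^T = d%:M by exact: mx11_scalar.
  rewrite linearZ/= -scalemxAl -scalemxAr scalerA -invfM -expr2.
  by rewrite sqr_sqrtr ?ltW// dE scale_scalar_mx mulVf// gt_eqF.
have uU : u \in U by rewrite memvZ// memv_pick.
pose f : 'Hom('rV[R]_n, 'rV[R]_1) := linfun (mulmxr u^T).
have fE w : f w = w *m u^T by rewrite lfunE.
have dim1 : \dim (f @: U) = 1%N.
  apply/eqP; rewrite eqn_leq; apply/andP; split.
    by rewrite (leq_trans (dimvS (subvf _)))// dimvf /dim /= mul1n.
  rewrite lt0n dimv_eq0; apply/negP => /eqP fU0.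
  have : f u \in (f @: U)%VS by rewrite memv_img.
  rewrite fU0 memv0 fE uu => /eqP /matrixP /(_ ord0 ord0).
  by rewrite !mxE eqxx mulr1n => /eqP; rewrite oner_eq0.
have [|B [BB BU]] := IH (U :&: lker f)%VS.
  by have := limg_ker_dim f U; rewrite dU dim1 addn1 => -[].
have Bu : B *m u^T = 0.
  apply/row_matrixP => i; rewrite row_mul row0 -fE.
  by have := BU i; rewrite memv_cap memv_ker => /andP[_ /eqP].
rewrite -[k.+1]/(1 + k)%N; exists (col_mx u B); split.
  rewrite tr_col_mx mul_col_row uu BB Bu.
  by rewrite -[u *m B^T]trmxK trmx_mul trmxK Bu trmx0 -scalar_mx_block.
move=> i; case: (split_ordP i) => j ->.
  rewrite (_ : row _ _ = u)//; apply/rowP => l.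
  by rewrite mxE col_mxEu (ord1 j).
rewrite (_ : row _ _ = row j B); first by have := BU j; rewrite memv_cap => /andP[].
by apply/rowP => l; rewrite mxE col_mxEd mxE.
Qed.

Lemma orthonormal_frameP (xi : {vspace 'rV[R]_n}) :
  let B := orthonormal_frame xi in
  B *m B^T = 1%:M /\ forall i, row i B \in xi.
Proof.
have [B hB] := gram_schmidt (erefl (\dim xi)).
by rewrite /= /orthonormal_frame; case: xgetP => [_ _ [] //|/(_ B)/(_ hB)].
Qed.

End orthonormal_frame.

Section surface_measure.
Context (R : realType) (n : nat).

Lemma measurable_enorm k : measurable_fun setT (@enorm R k).
Proof.
apply: (@measurableT_comp _ _ _ _ _ _ (@Num.sqrt R)).
  apply: continuous_measurable_fun; exact: sqrt_continuous.
apply: measurable_sum => i; apply: measurable_funX.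
exact: (@measurable_coord_rV _ _ i).
Qed.

Definition punctured_ball k : set 'rV[R]_k := [set v | 0 < enorm v <= 1].

Lemma measurable_punctured_ball k : measurable (@punctured_ball k).
Proof.
rewrite (_ : @punctured_ball k = @enorm R k @^-1` `]0, 1]%classic).
  by rewrite -[X in measurable X]setTI; exact: measurable_enorm.
by apply/seteqP; split=> v; rewrite /punctured_ball/= in_itv.
Qed.

(* For B with orthonormal rows spanning xi, the radial projection
   v |-> vB / |v| of R^k minus the origin onto the unit sphere of xi. *)
Definition radial_proj k (B : 'M[R]_(k, n)) (v : 'rV[R]_k) : 'rV[R]_n :=
  (enorm v)^-1 *: (v *m B).

Lemma measurable_radial_proj k (B : 'M[R]_(k, n)) :
  measurable_fun setT (radial_proj B).
Proof.
apply: measurable_fun_rV => i.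
rewrite (_ : _ \o _ =
    fun v => (enorm v)^-1 * \sum_j coord_rV j v * B j i); last first.
  by apply/funext => v; rewrite /coord_rV /radial_proj /= mxE mxE.
apply: measurable_funM.
  under eq_fun do rewrite -powR_inv1 ?sqrtr_ge0//.
  apply: (measurableT_comp (measurable_powR _)) => //; exact: measurable_enorm.
apply: measurable_sum => j; apply: measurable_funM => //.
exact: measurable_coord_rV.
Qed.

(* Surface area measure on the unit sphere of xi, k = \dim xi, as k times the
   k-dimensional Lebesgue measure of the truncated cone
   { r theta | 0 < r <= 1, theta \in A }, computed in an orthonormal basis. *)
Definition surface_measure (xi : {vspace 'rV[R]_n}) (A : set 'rV[R]_n) : \bar R :=
  (\dim xi)%:R%:E * lebesgue_rV R (\dim xi)
    (radial_proj (orthonormal_frame xi) @^-1` A `&` @punctured_ball (\dim xi)).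

Section is_measure.
Variable xi : {vspace 'rV[R]_n}.

Let B := orthonormal_frame xi.
Let mu := mscale ((\dim xi)%:R : R)%:nng
  (mrestr (lebesgue_rV R (\dim xi)) (@measurable_punctured_ball (\dim xi))).

Let preim A : measurable A -> measurable (radial_proj B @^-1` A).
Proof.
by move=> mA; rewrite -[X in measurable X]setTI; exact: measurable_radial_proj.
Qed.

Let surface_measure0 : surface_measure xi set0 = 0%E.
Proof. by rewrite /surface_measure preimage_set0 set0I measure0 mule0. Qed.

Let surface_measure_ge0 A : (0 <= surface_measure xi A)%E.
Proof. by apply: mule_ge0; [rewrite lee_fin|exact: measure_ge0]. Qed.

Let surface_measure_additive : semi_sigma_additive (surface_measure xi).
Proof.
move=> F mF tF mUF.
rewrite [X in _ --> X](_ : _ = mu (\bigcup_i (radial_proj B @^-1` F i))); last first.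
  by rewrite /surface_measure preimage_bigcup.
apply: (@measure_semi_sigma_additive _ _ _ mu).
- by move=> k; exact: preim.
- apply/trivIsetP => /= i j _ _ ij; rewrite -preimage_setI.
  by move/trivIsetP : tF => /(_ _ _ _ _ ij) ->//; rewrite preimage_set0.
- by rewrite -preimage_bigcup; exact: preim.
Qed.

HB.instance Definition _ := isMeasure.Build _ _ _ (surface_measure xi)
  surface_measure0 surface_measure_ge0 surface_measure_additive.

End is_measure.

Definition unit_sphere (xi : {vspace 'rV[R]_n}) : set 'rV[R]_n :=
  [set theta | enorm theta = 1 /\ theta \in xi].

End surface_measure.

(* The surface measure extended to all sets measurable for its completion. *)
Section completed_surface_measure.
Context (R : realType) (n : nat) (xi : {vspace 'rV[R]_n}).

Definition completed_surface_measure :=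
  @completed_measure_extension _ 'rV[R]_n R (surface_measure xi).

HB.instance Definition _ := Measure.on completed_surface_measure.

End completed_surface_measure.
Arguments completed_surface_measure {R n} xi _.

Section tangent_mean.
Context (R : realType).

Definition Gamma (a : R) : R :=
  \int[lebesgue_measure]_(x in `]0%R, +oo[) (x `^ (a - 1) * expR (- x)).

(* [sphere_area k] is the area of the unit sphere of R^k. *)
Definition sphere_area (k : nat) : R :=
  2 * pi `^ (k%:R / 2) / Gamma (k%:R / 2).

Definition Grass_through (n k : nat) (x : 'rV[R]_n) : set {vspace 'rV[R]_n} :=
  [set xi | \dim xi = k /\ x \in xi].

Definition Q_integrand n (f : 'rV[R]_n -> R) (x theta : 'rV[R]_n) : R :=
  f (x + (enorm x - 1) *: theta).

Definition Q_minus_exists n (f : 'rV[R]_n -> R) (x : 'rV[R]_n)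
    (xi : {vspace 'rV[R]_n}) : Prop :=
  (completed_surface_measure xi).-integrable (unit_sphere xi)
    (fun theta => (Q_integrand f x theta)%:E).

Definition Q_minus n (f : 'rV[R]_n -> R) (x : 'rV[R]_n)
    (xi : {vspace 'rV[R]_n}) : R :=
  (sphere_area (\dim xi))^-1 *
  \int[completed_surface_measure xi]_(theta in unit_sphere xi)
    Q_integrand f x theta.

(* Real exponents: (k - 3) / 2 must not be read with truncated subtraction. *)
Definition F_integrand (k : nat) (f1 : R -> R) (t s : R) : R :=
  (t ^+ 2 - s ^+ 2) `^ ((k%:R - 3) / 2) * f1 s * s.

Definition F_minus_exists (k : nat) (f1 : R -> R) (t : R) : Prop :=
  (@completed_lebesgue_measure R).-integrable `]1%R, t[
    (fun s => (F_integrand k f1 t s)%:E).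

Definition F_minus (k : nat) (f1 : R -> R) (t : R) : R :=
  2 / Gamma ((k%:R - 1) / 2) *
  \int[@completed_lebesgue_measure R]_(s in `]1%R, t[) F_integrand k f1 t s.

Definition Phi_minus (k : nat) (f1 : R -> R) (t : R) : R :=
  Gamma (k%:R / 2) / pi `^ (1 / 2) *
  ((t ^+ 2 - 1) / 2) `^ (2 - k%:R) * F_minus k f1 t.

End tangent_mean.

(* Main.v *)
(** In an orthonormal basis of xi, the sphere integral is k times an integral
    over the unit ball of R^k of a function of e.v / |v|, where e holds the
    coordinates of x; the distance s = |x + (|x| - 1) theta| satisfies
    s^2 = mid_sq + 2 (|x| - 1) (e.v / |v|).  The joint law of (e.v, |v|^2) under
    Lebesgue measure only depends on |e|, so e may be taken along the first axis.
    Writing v = (v0, w) with w in R^(k-1), the law of |w| has density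
    sphere_area (k-1) r^(k-2), the constant coming from the Gaussian integral.
    After v0 = r z the radial integral is elementary, and z as a function of s
    is [tangent_sub], which maps ]1, t[ increasingly onto R; its Jacobian produces
    the kernel of F_-.  This holds for nonnegative Borel functions; the completed
    measures are reached by replacing f0 by a Borel function equal to it off a
    null set. *)

Require Import Defs.
From HB Require Import structures.
From mathcomp Require Import all_boot all_order all_algebra.
From mathcomp Require Import all_classical all_reals all_analysis.
From mathcomp Require Import measurable_realfun ring lra.

Import Order.TTheory GRing.Theory Num.Theory.
Import numFieldNormedType.Exports.

Set Implicit Arguments.
Unset Strict Implicit.
Unset Printing Implicit Defensive.

Local Open Scope classical_set_scope.
Local Open Scope ring_scope.

(** * Densities, images and uniqueness of measures *)

(** Each one-dimensional change of variable is proved as an equality of measures: an image or a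
    density is compared with its target on rays or half-open intervals, where an antiderivative
    settles the matter, and uniqueness extends the equality to Borel sets. The integrand is thus
    never asked to be continuous. The delicate point is the transport of null sets. The Borel
    replacement is found on the line, from the integrand of $F_-$, while the conclusion concerns the
    sphere. Applied to the indicator of a null set, the formula for nonnegative functions shows that
    the law of the distance $s$ has a density on ]1, t[; the exceptional radii, together with the
    end values 1 and $t$, therefore pull back to a null set of directions. As for constants, the
    factor $k$ in the surface measure cancels against the integral of $r^{k-1}$, which leaves
    [sphere_area] of $k-1$; its quotient by [sphere_area] of $k$ is
    $\Gamma(k/2)/(\pi^{1/2}\Gamma((k-1)/2))$. *)

Section density.
Context d (T : measurableType d) (R : realType).
Variables (mu : {measure set T -> \bar R}) (w : T -> R).
Hypotheses (mw : measurable_fun setT w) (w0 : forall x, 0 <= w x).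

Definition density_measure (A : set T) : \bar R := (\int[mu]_(x in A) (w x)%:E)%E.

Let density0 : density_measure set0 = 0%E.
Proof. exact: integral_set0. Qed.

Let density_ge0 A : (0 <= density_measure A)%E.
Proof. by apply: integral_ge0 => x _; rewrite lee_fin. Qed.

Let density_sigma_additive : semi_sigma_additive density_measure.
Proof.
move=> F mF tF mUF; rewrite /density_measure.
rewrite ge0_integral_bigcup//; last 2 first.
- exact/measurable_EFinP/measurable_funTS.
- by move=> x _; rewrite lee_fin.
by apply: is_cvg_ereal_nneg_natsum_cond => n _ _; exact: density_ge0.
Qed.

HB.instance Definition _ := isMeasure.Build _ _ _ density_measure
  density0 density_ge0 density_sigma_additive.

Definition density : {measure set T -> \bar R} := density_measure.

Import HBNNSimple.

(** Monotone convergence on both sides along one increasing simple approximation of [f] reduces the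
    identity to simple functions, where it is linear in the indicators. *)
Lemma ge0_integral_density (f : T -> \bar R) :
  measurable_fun setT f -> (forall x, 0 <= f x)%E ->
  (\int[density]_x f x = \int[mu]_x (f x * (w x)%:E))%E.
Proof.
move=> mf f0; pose f_ := nnsfun_approx measurableT mf.
have fE x : f x = limn (fun n => (f_ n x)%:E).
  by apply/esym/cvg_lim => //; exact: cvg_nnsfun_approx.
have nd n m : (n <= m)%N -> forall x, f_ n x <= f_ m x.
  by move=> nm x; exact/lefP/nd_nnsfun_approx.
transitivity (limn (fun n => \int[density]_x (f_ n x)%:E)%E).
  rewrite -monotone_convergence//.
  - by apply: eq_integral => x _; exact: fE.
  - by move=> n; exact/measurable_EFinP.
  - by move=> n x _; rewrite lee_fin.
  - by move=> x _ n m nm; rewrite lee_fin; exact: nd.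
transitivity (limn (fun n => \int[mu]_x ((f_ n x)%:E * (w x)%:E))%E); last first.
  rewrite -monotone_convergence//.
  - apply: eq_integral => x _; rewrite fE; apply/cvg_lim => //.
    apply: cvgeZr => //; rewrite -fE.
    exact: cvg_nnsfun_approx.
  - by move=> n; apply: emeasurable_funM; exact/measurable_EFinP.
  - by move=> n x _; rewrite mule_ge0// lee_fin.
  - by move=> x _ n m nm; rewrite lee_wpmul2r// lee_fin; [exact: w0|exact: nd].
congr (limn _); apply/funext => n.
rewrite integralT_nnsfun sintegralE.
under [RHS]eq_integral => x _.
  rewrite fimfunE -fsumEFin// ge0_mule_fsuml; last first.
    by move=> r; rewrite nnfun_muleindic_ge0.
  over.
rewrite ge0_integral_fsum//; last 2 first.
- move=> r; apply: emeasurable_funM; apply/measurable_EFinP => //.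
  exact: measurable_funM.
- by move=> r x _; rewrite mule_ge0 ?nnfun_muleindic_ge0// lee_fin.
(* A negative value has empty preimage; removing it keeps the scalar taken out of the integral
   nonnegative. *)
apply: eq_fsbigr => r _; have [r0|r0] := ltP r 0.
  rewrite preimage_nnfun0// measure0 mule0 integral0_eq// => x _.
  by rewrite indic0 mulr0 mul0e.
under eq_integral do rewrite EFinM -muleA.
rewrite ge0_integralZl//; last 2 first.
- by apply: emeasurable_funM; exact/measurable_EFinP.
- by move=> x _; rewrite mule_ge0// lee_fin.
congr *%E; rewrite [LHS]integral_mkcond.
apply: eq_integral => x _; rewrite patchE indicE.
by case: ifPn => _; rewrite ?mul1e ?mul0e.
Qed.

End density.

(** Left rays are stable under intersection and the rays ending at the naturals exhaust the line.
    Finiteness on rays fits measures carried by the positive half-line, such as laws of radii. *)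
Lemma measure_unique_ray (R : realType)
    (m1 m2 : {measure set (measurableTypeR R) -> \bar R}) :
  (forall b, m1 `]-oo, b[%classic = m2 `]-oo, b[%classic) ->
  (forall b, m1 `]-oo, b[%classic < +oo)%E ->
  forall A, measurable A -> m1 A = m2 A.
Proof.
move=> m12 m1oo A mA.
apply: (@measure_unique _ R (measurableTypeR R) (@RGenInftyO.G R)
  (fun k => `]-oo, k%:R[%classic)) => //.
- exact: RGenInftyO.measurableE.
- move=> _ _ [x ->] [y ->]; exists (Num.min x y); apply/seteqP; split=> z /=.
    by rewrite !in_itv/= lt_min => -[-> ->].
  by rewrite !in_itv/= lt_min => /andP[-> ->].
- by move=> k; exists k%:R.
- apply/seteqP; split=> // x _; exists (Num.truncn `|x|).+1 => //=.
  rewrite in_itv/=; apply: le_lt_trans (ler_norm x) _.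
  exact: truncnS_gt.
- by move=> _ [x ->].
Qed.

Definition image_measure d1 d2 (T1 : measurableType d1) (T2 : measurableType d2)
    (R : realType) (m : {measure set T1 -> \bar R}) (f : T1 -> T2)
    (mf : measurable_fun setT f) : {measure set T2 -> \bar R} :=
  measure_function_pushforward__canonical__measure_function_Measure m mf.

Lemma ge0_integral_image d1 d2 (T1 : measurableType d1) (T2 : measurableType d2)
    (R : realType) (m : {measure set T1 -> \bar R}) (f : T1 -> T2)
    (mf : measurable_fun setT f) (g : T2 -> \bar R) :
  measurable_fun setT g -> (forall y, 0 <= g y)%E ->
  (\int[image_measure m mf]_y g y = \int[m]_x g (f x))%E.
Proof. by move=> mg g0; rewrite ge0_integral_pushforward// preimage_setT. Qed.

(** * Affine substitutions and rotations *)

Section affine_substitution.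
Context (R : realType).
Local Notation mu := (@lebesgue_measure R).

Let aff (c d : R) (x : R) := c * x + d.

Let maff (c d : R) : measurable_fun setT (aff c d : measurableTypeR R -> measurableTypeR R).
Proof. by apply: measurable_funD => //; exact: measurable_funM. Qed.

(** The rescaled image measure has the right value on each ]a, b]. A negative slope exchanges the
    open and the closed end, hence two cases. *)
Lemma lebesgue_measure_affine (c d : R) (A : set R) : c != 0 -> measurable A ->
  (mu A = `|c|%:E * mu ((fun x => c * x + d)%R @^-1` A))%E.
Proof.
move=> c0 mA.
pose m := mscale (NngNum (normr_ge0 c)) (image_measure mu (maff c d)).
have mE : forall X, ocitv X -> mu X = m X.
  move=> _ [[a b]] _ <-; rewrite /m /mscale /= /pushforward.
  have [c_lt|c_gt|c0'] := ltgtP c 0; last by rewrite c0' eqxx in c0.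
  - rewrite (_ : _ @^-1` _ = `[(b - d) / c, (a - d) / c[%classic); last first.
      apply/seteqP; split => x /=; rewrite !in_itv/= /aff
        ler_ndivrMr// ltr_ndivlMr// lerBrDr ltrBlDr [x * c]mulrC.
        by move=> /andP[-> ->].
      by move=> /andP[-> ->].
    rewrite !lebesgue_measure_itv/= !lte_fin ltr_nM2r ?invr_lt0// ltrD2r.
    case: ifPn => _; rewrite ?mule0// -!EFinD -EFinM ltr0_norm//; congr EFin.
    by field.
  - rewrite (_ : _ @^-1` _ = `](a - d) / c, (b - d) / c]%classic); last first.
      apply/seteqP; split => x /=; rewrite !in_itv/= /aff
        ler_pdivlMr// ltr_pdivrMr// lerBrDr ltrBlDr [x * c]mulrC.
        by move=> /andP[-> ->].
      by move=> /andP[-> ->].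
    rewrite !lebesgue_measure_itv/= !lte_fin ltr_pM2r ?invr_gt0// ltrD2r.
    case: ifPn => _; rewrite ?mule0// -!EFinD -EFinM gtr0_norm//; congr EFin.
    by field.
exact: (lebesgue_measure_unique mE mA).
Qed.

Lemma ge0_integral_affine (c d : R) (f : R -> \bar R) : c != 0 ->
  measurable_fun setT f -> (forall x, 0 <= f x)%E ->
  (\int[mu]_x f x = `|c|%:E * \int[mu]_x f (c * x + d)%R)%E.
Proof.
move=> c0 mf f0.
pose m := mscale (NngNum (normr_ge0 c)) (image_measure mu (maff c d)).
transitivity (\int[m]_x f x)%E.
  apply: eq_measure_integral => A mA _; exact: lebesgue_measure_affine.
rewrite ge0_integral_mscale//; congr *%E.
exact: ge0_integral_image.
Qed.

End affine_substitution.

Ltac measurable_tac :=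
  repeat match goal with
  | |- measurable_fun _ (fun _ => (_, _)) => apply: measurable_fun_pair
  | |- measurable_fun _ (fun _ => (_ + _)%R) => apply: measurable_funD
  | |- measurable_fun _ (fun _ => (_ - _)%R) => apply: measurable_funB
  | |- measurable_fun _ (fun _ => (- _)%R) => apply: measurable_funN
  | |- measurable_fun _ (fun _ => (_ * _)%R) => apply: measurable_funM
  | |- measurable_fun _ (fun _ => (_ ^+ _)%R) => apply: measurable_funX
  end; rewrite //=.

Ltac meas_comp H := apply: (measurableT_comp H); measurable_tac.

Lemma tonelli_swap d1 d2 (T1 : measurableType d1) (T2 : measurableType d2)
    (R : realType) (m1 : {sigma_finite_measure set T1 -> \bar R})
    (m2 : {sigma_finite_measure set T2 -> \bar R}) (g : T1 -> T2 -> \bar R) :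
  measurable_fun setT (fun z => g z.1 z.2) -> (forall x y, 0 <= g x y)%E ->
  (\int[m1]_x \int[m2]_y g x y = \int[m2]_y \int[m1]_x g x y)%E.
Proof. by move=> mg g0; apply: (fubini_tonelli (fun z => g z.1 z.2)). Qed.

Lemma tonelli_swapR (R : realType) (g : R -> R -> \bar R) :
  measurable_fun setT (fun z : R * R => g z.1 z.2) ->
  (forall x y, 0 <= g x y)%E ->
  (\int[lebesgue_measure]_x \int[lebesgue_measure]_y g x y =
   \int[lebesgue_measure]_y \int[lebesgue_measure]_x g x y)%E.
Proof. by move=> mg g0; exact: (tonelli_swap lebesgue_measure lebesgue_measure). Qed.

Lemma measurable_fun_integral2 d1 d2 (T1 : measurableType d1)
    (T2 : measurableType d2) (R : realType)
    (m2 : {sigma_finite_measure set T2 -> \bar R}) (g : T1 -> T2 -> \bar R) :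
  measurable_fun setT (fun z => g z.1 z.2) -> (forall x y, 0 <= g x y)%E ->
  measurable_fun setT (fun x => \int[m2]_y g x y)%E.
Proof.
move=> mg g0; apply: (measurable_fun_fubini_tonelli_F (fun z => g z.1 z.2)) => //.
Qed.

Lemma measurable_fun_integral1 d1 d2 (T1 : measurableType d1)
    (T2 : measurableType d2) (R : realType)
    (m1 : {sigma_finite_measure set T1 -> \bar R}) (g : T1 -> T2 -> \bar R) :
  measurable_fun setT (fun z => g z.1 z.2) -> (forall x y, 0 <= g x y)%E ->
  measurable_fun setT (fun y => \int[m1]_x g x y)%E.
Proof.
move=> mg g0; apply: (measurable_fun_fubini_tonelli_G (fun z => g z.1 z.2)) => //.
Qed.

Section rotation.
Context (R : realType).
Local Notation mu := (@lebesgue_measure R).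
Local Open Scope ereal_scope.

(* First p = a x + b y is substituted for x, then y is replaced by the
   variable q completing the square in x^2 + y^2 = q^2 + p^2 / rho^2. *)
Lemma ge0_integral_rotation2 (G : R * R -> \bar R) (a b : R) :
  measurable_fun setT G -> (forall p, 0 <= G p) ->
  \int[mu]_x \int[mu]_y G (a * x + b * y, x ^+ 2 + y ^+ 2)%R =
  \int[mu]_x \int[mu]_y G (Num.sqrt (a ^+ 2 + b ^+ 2) * x, x ^+ 2 + y ^+ 2)%R.
Proof.
move=> mG G0.
(* Solving for [x] divides by [a]. If only [b] is nonzero, the two variables are exchanged by
   Tonelli; if both vanish, the sides coincide. *)
wlog a0 : a b / (a != 0)%R => [wlg|].
  have [a0|] := eqVneq a 0%R; last exact: wlg.
  have [b0|b0] := eqVneq b 0%R.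
    rewrite a0 b0 expr0n addr0 sqrtr0; apply: eq_integral => x _.
    by apply: eq_integral => y _; rewrite !mul0r addr0.
  rewrite [LHS]tonelli_swapR; last 2 first.
  - by meas_comp mG.
  - by move=> x y; exact: G0.
  rewrite [in RHS]addrC -(wlg b a b0).
  by apply: eq_integral => y _; apply: eq_integral => x _; congr (G (_, _)); rewrite addrC.
set rho := Num.sqrt (a ^+ 2 + b ^+ 2).
have rho_gt0 : (0 < rho)%R.
  by rewrite sqrtr_gt0 ltr_wpDr ?sqr_ge0// exprn_even_gt0.
have rho_neq0 : (rho != 0)%R by rewrite gt_eqF.
have rho2 : (rho ^+ 2 = a ^+ 2 + b ^+ 2)%R by rewrite sqr_sqrtr// addr_ge0 ?sqr_ge0.
rewrite [LHS]tonelli_swapR; last 2 first.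
- by meas_comp mG.
- by move=> x y; exact: G0.
have mG2 : measurable_fun setT
    (fun z : R * R => G (z.1, ((z.1 - b * z.2) / a) ^+ 2 + z.2 ^+ 2)%R).
  by meas_comp mG.
transitivity (\int[mu]_y (`|a|^-1%:E * \int[mu]_p
    G (p, ((p - b * y) / a) ^+ 2 + y ^+ 2)%R)).
  apply: eq_integral => y _.
  rewrite [X in _ = _ * X](@ge0_integral_affine _ a (b * y))//.
    rewrite muleA -EFinM mulVf ?normr_eq0// mul1e; apply: eq_integral => x _.
    by congr (G (_, _ + _)%R); field.
  by meas_comp mG.
rewrite ge0_integralZl ?lee_fin//; last 2 first.
- apply: (measurable_fun_integral1 mu mG2) => x y; exact: G0.
- by move=> y _; exact: integral_ge0.
rewrite [X in _ * X](esym (tonelli_swapR mG2 _)); last first.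
  by move=> x y; exact: G0.
have mG3 : measurable_fun setT
    (fun z : R * R => G (z.1, (z.1 / rho) ^+ 2 + z.2 ^+ 2)%R).
  by meas_comp mG.
transitivity (`|a|^-1%:E * \int[mu]_p (`|a / rho|%:E *
    \int[mu]_q G (p, (p / rho) ^+ 2 + q ^+ 2)%R)).
  congr *%E; apply: eq_integral => p _.
  (* For fixed [p], the quadratic $((p-by)/a)^2+y^2$ is least at $y=bp/\rho^2$ and has leading
     coefficient $(\rho/a)^2$, so $q=(\rho/a)(y-bp/\rho^2)$. *)
  rewrite [X in _ = _ * X](@ge0_integral_affine _ (rho / a)
    (- (b * p / (a * rho))))//; last 2 first.
  - by rewrite mulf_neq0 ?invr_eq0.
  - by meas_comp mG.
  rewrite muleA -EFinM -normrM [X in `|X|%R](_ : _ = 1)%R; last first.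
    by field; rewrite a0.
  rewrite normr1 mul1e; apply: eq_integral => y _; congr (G (_, _)%R).
  have -> : ((p / rho) ^+ 2 + (rho / a * y - b * p / (a * rho)) ^+ 2 =
     (p ^+ 2 * (a ^+ 2 + b ^+ 2) / rho ^+ 2 - 2 * b * p * y + rho ^+ 2 * y ^+ 2) / a ^+ 2)%R.
    by field; rewrite a0.
  by rewrite -rho2 mulfK ?expf_neq0// rho2; field.
rewrite ge0_integralZl ?lee_fin//; last 2 first.
- apply: (measurable_fun_integral2 mu mG3) => x y; exact: G0.
- by move=> y _; exact: integral_ge0.
rewrite [X in _ * (_ * X)](@ge0_integral_affine _ rho 0)//; last 2 first.
- apply: (measurable_fun_integral2 mu mG3) => x y; exact: G0.
- by move=> x; exact: integral_ge0.
(* The three Jacobians $1/|a|$, $|a/\rho|$ and $|\rho|$ multiply to one. *)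
rewrite !muleA -!EFinM -[in X in (X * _)%R]normfV -!normrM [X in `|X|%R](_ : _ = 1)%R; last first.
  by field; rewrite a0 rho_neq0.
rewrite [X in X%:E]normr1 mul1e; apply: eq_integral => x _; apply: eq_integral => y _.
by congr (G (_, _ + _)%R); rewrite addr0// [(rho * x)%R]mulrC mulfK.
Qed.

End rotation.

(** * Integration on R^n *)

Section lebesgue_rV_integral.
Context (R : realType).
Local Notation mu := (@lebesgue_measure R).

Definition dot n (e v : 'rV[R]_n) : R := \sum_i e ord0 i * v ord0 i.

Lemma measurable_dot n (e : 'rV[R]_n) : measurable_fun setT (dot e).
Proof.
apply: measurable_sum => i; apply: measurable_funM => //.
exact: (@measurable_coord_rV _ _ i).
Qed.

Lemma cons_rV0 n (x : R) (v : 'rV[R]_n) : cons_rV (x, v) ord0 ord0 = x.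
Proof. by rewrite -[LHS]/((coord_rV ord0 \o @cons_rV R n) (x, v)) coord_cons_rV0. Qed.

Lemma cons_rVS n (x : R) (v : 'rV[R]_n) i :
  cons_rV (x, v) ord0 (lift ord0 i) = v ord0 i.
Proof. by rewrite -[LHS]/((coord_rV (lift ord0 i) \o @cons_rV R n) (x, v)) coord_cons_rVS. Qed.

Lemma rV_cons n (v : 'rV[R]_n.+1) :
  v = cons_rV (v ord0 ord0, \row_i v ord0 (lift ord0 i)).
Proof.
apply/rowP => i; have [j ->|->] := unliftP ord0 i; last by rewrite cons_rV0.
by rewrite cons_rVS mxE.
Qed.

Lemma scale_cons_rV n (r x : R) (v : 'rV[R]_n) :
  r *: cons_rV (x, v) = cons_rV (r * x, r *: v).
Proof.
apply/rowP => i; rewrite mxE; have [j ->|->] := unliftP ord0 i.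
  by rewrite !cons_rVS mxE.
by rewrite !cons_rV0.
Qed.

Lemma dot_cons n (a x : R) (e v : 'rV[R]_n) :
  dot (cons_rV (a, e)) (cons_rV (x, v)) = a * x + dot e v.
Proof.
rewrite /dot big_ord_recl !cons_rV0; congr +%R.
by apply: eq_bigr => i _; rewrite !cons_rVS.
Qed.

Lemma enorm_ge0 n (v : 'rV[R]_n) : 0 <= enorm v.
Proof. exact: sqrtr_ge0. Qed.

Lemma sqr_enorm n (v : 'rV[R]_n) : enorm v ^+ 2 = \sum_i v ord0 i ^+ 2.
Proof. by rewrite sqr_sqrtr// sumr_ge0// => i _; exact: sqr_ge0. Qed.

Lemma sqr_enorm_cons n (x : R) (v : 'rV[R]_n) :
  enorm (cons_rV (x, v)) ^+ 2 = x ^+ 2 + enorm v ^+ 2.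
Proof.
rewrite !sqr_enorm big_ord_recl cons_rV0; congr +%R.
by apply: eq_bigr => i _; rewrite cons_rVS.
Qed.

Lemma enormZ n (r : R) (v : 'rV[R]_n) : enorm (r *: v) = `|r| * enorm v.
Proof.
rewrite /enorm -sqrtr_sqr -sqrtrM ?sqr_ge0// mulr_sumr.
by congr Num.sqrt; apply: eq_bigr => i _; rewrite mxE exprMn.
Qed.

Lemma enorm_rV0 (v : 'rV[R]_0) : enorm v = 0.
Proof. by rewrite /enorm big_ord0 sqrtr0. Qed.

Lemma measurable_sqr_enorm n : measurable_fun setT (fun v : 'rV[R]_n => enorm v ^+ 2).
Proof. by apply: measurable_funX; exact: measurable_enorm. Qed.

Local Open Scope ereal_scope.

Lemma ge0_integral_rV0 (f : 'rV[R]_0 -> \bar R) : measurable_fun setT f ->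
  \int[lebesgue_rV R 0]_v f v = f 0%R.
Proof.
move=> mf; transitivity (\int[\d_ (0%R : 'rV[R]_0)]_v f v); first by [].
by rewrite integral_dirac// diracT mul1e.
Qed.

Lemma ge0_integral_rVS n (f : 'rV[R]_n.+1 -> \bar R) :
  measurable_fun setT f -> (forall v, 0 <= f v) ->
  \int[lebesgue_rV R n.+1]_v f v =
  \int[mu]_x \int[lebesgue_rV R n]_v f (cons_rV (x, v)).
Proof.
move=> mf f0.
transitivity (\int[image_measure (mu \x lebesgue_rV R n)
  (@measurable_cons_rV R n)]_v f v); first by [].
rewrite ge0_integral_image//.
rewrite (@fubini_tonelli1 _ _ _ _ _ mu (lebesgue_rV R n))//.
by apply: measurableT_comp => //; exact: measurable_cons_rV.
Qed.

Lemma measurable_fun_cons_rV n (f : 'rV[R]_n.+1 -> \bar R) :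
  measurable_fun setT f ->
  measurable_fun setT (fun z : R * 'rV[R]_n => f (cons_rV (z.1, z.2))).
Proof.
move=> mf; apply: (measurableT_comp mf).
rewrite (_ : (fun _ => _) = @cons_rV R n); first exact: measurable_cons_rV.
by apply/funext => -[].
Qed.

Lemma measurable_fun_integral_cons n (f : 'rV[R]_n.+1 -> \bar R) :
  measurable_fun setT f -> (forall v, 0 <= f v) ->
  measurable_fun setT (fun x : R => \int[lebesgue_rV R n]_v f (cons_rV (x, v))).
Proof.
move=> mf f0; apply: (measurable_fun_integral2 (lebesgue_rV R n)
  (measurable_fun_cons_rV mf)) => x v; exact: f0.
Qed.

Lemma measurable_fun_cons_rV2 n (f : 'rV[R]_n.+1 -> \bar R) x :
  measurable_fun setT f ->
  measurable_fun setT (fun v : 'rV[R]_n => f (cons_rV (x, v))).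
Proof.
move=> mf; apply: (measurableT_comp mf).
apply: measurableT_comp; first exact: measurable_cons_rV.
exact: pair1_measurable.
Qed.

Lemma measurable_scale_rV n (r : R) :
  measurable_fun setT (fun v : 'rV[R]_n => r *: v)%R.
Proof.
apply: measurable_fun_rV => i.
rewrite (_ : _ \o _ = fun v => r * coord_rV i v)%R; last first.
  by apply/funext => v; rewrite /coord_rV /= mxE.
by apply: measurable_funM => //; exact: measurable_coord_rV.
Qed.

Lemma ge0_integral_rV_scale n (r : R) (f : 'rV[R]_n -> \bar R) : (0 < r)%R ->
  measurable_fun setT f -> (forall v, 0 <= f v) ->
  \int[lebesgue_rV R n]_v f v = (r ^+ n)%:E * \int[lebesgue_rV R n]_v f (r *: v)%R.
Proof.
move=> r0; elim: n f => [|n IH] f mf f0.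
  rewrite ge0_integral_rV0// ge0_integral_rV0.
    by rewrite expr0 mul1e scaler0.
  by apply: (measurableT_comp mf); exact: measurable_scale_rV.
rewrite [LHS]ge0_integral_rVS// [X in _ * X]ge0_integral_rVS; last 2 first.
- by apply: (measurableT_comp mf); exact: measurable_scale_rV.
- by [].
rewrite [LHS](@ge0_integral_affine _ r 0); last 3 first.
- by rewrite gt_eqF.
- exact: measurable_fun_integral_cons.
- by move=> x; exact: integral_ge0.
rewrite (gtr0_norm r0) exprS EFinM -muleA; congr *%E.
rewrite -ge0_integralZl; last 4 first.
- by [].
- apply: (@measurable_fun_integral_cons _ (fun v => f (r *: v)%R)) => //.
  by apply: (measurableT_comp mf); exact: measurable_scale_rV.
- by move=> x _; exact: integral_ge0.
- by rewrite lee_fin exprn_ge0// ltW.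
apply: eq_integral => x _; rewrite IH; last 2 first.
- exact: measurable_fun_cons_rV2.
- by move=> v; exact: f0.
by congr *%E; apply: eq_integral => v _; rewrite scale_cons_rV addr0.
Qed.

End lebesgue_rV_integral.

Section rotation_rV.
Context (R : realType).
Local Notation mu := (@lebesgue_measure R).
Local Open Scope ereal_scope.

(** No orthogonal matrix is constructed. By induction on the dimension, the trailing part [e'] of
    [e] is first turned onto one axis, and the planar lemma then merges the first entry of [e] with
    [enorm e']. In dimension one only a reflection remains. *)
Lemma ge0_integral_rotation n (e : 'rV[R]_n.+1) (H : R * R -> \bar R) :
  measurable_fun setT H -> (forall p, 0 <= H p) ->
  \int[lebesgue_rV R n.+1]_v H (dot e v, enorm v ^+ 2)%R =
  \int[lebesgue_rV R n.+1]_v H (enorm e * v ord0 ord0, enorm v ^+ 2)%R.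
Proof.
elim: n e H => [|n IH] e H mH H0.
all: have mHd m (e' : 'rV[R]_m) : measurable_fun setT
    (fun v => H (dot e' v, enorm v ^+ 2)%R) by
  apply: (measurableT_comp mH); apply: measurable_fun_pair;
  [exact: measurable_dot|exact: measurable_sqr_enorm].
all: have mHc m (a : R) : measurable_fun setT
    (fun v : 'rV[R]_m.+1 => H (a * v ord0 ord0, enorm v ^+ 2)%R) by
  apply: (measurableT_comp mH); apply: measurable_fun_pair;
  [apply: measurable_funM => //; exact: (@measurable_coord_rV _ _ ord0)
  |exact: measurable_sqr_enorm].
  pose a := e ord0 ord0.
  have eE : enorm e = `|a|%R by rewrite /enorm big_ord1 sqrtr_sqr.
  transitivity (\int[lebesgue_rV R 1]_v H (a * v ord0 ord0, enorm v ^+ 2)%R).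
    by apply: eq_integral => v _; rewrite /dot big_ord1.
  rewrite eE; have [a0|a0] := leP 0%R a; first by rewrite (ger0_norm a0).
  rewrite (ltr0_norm a0).
  rewrite [LHS]ge0_integral_rVS; last 2 first.
  - exact: mHc.
  - by move=> v; exact: H0.
  rewrite [RHS]ge0_integral_rVS; last 2 first.
  - exact: mHc.
  - by move=> v; exact: H0.
  rewrite [RHS](@ge0_integral_affine _ (-1) 0)%R; last 3 first.
  - by rewrite oppr_eq0 oner_eq0.
  - by apply: (measurable_fun_integral_cons (mHc _ _)) => v; exact: H0.
  - by move=> x; exact: integral_ge0.
  rewrite normrN1 mul1e; apply: eq_integral => x _; apply: eq_integral => v _.
  rewrite !sqr_enorm_cons !cons_rV0; congr (H (_, _ + _)%R); first by ring.
  by rewrite addr0 mulN1r sqrrN.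
pose a := e ord0 ord0; pose e' : 'rV[R]_n.+1 := (\row_i e ord0 (lift ord0 i))%R.
have eE : e = cons_rV (a, e') by exact: rV_cons.
have nE : enorm e = Num.sqrt (a ^+ 2 + enorm e' ^+ 2).
  by rewrite -sqr_enorm_cons -eE sqrtr_sqr ger0_norm// enorm_ge0.
have mHw : measurable_fun setT (fun z : (R * R) * 'rV[R]_n =>
    H (z.1.1, z.1.2 + enorm z.2 ^+ 2)%R).
  apply: (measurableT_comp mH); apply: measurable_fun_pair.
    exact: (measurableT_comp measurable_fst).
  apply: measurable_funD; first exact: (measurableT_comp measurable_snd).
  exact: (measurableT_comp (@measurable_sqr_enorm R n) measurable_snd).
(* The coordinates beyond the first two enter only through their square norm, so they are integrated
   out before the planar lemma is applied. *)
pose G (p : R * R) := \int[lebesgue_rV R n]_w H (p.1, p.2 + enorm w ^+ 2)%R.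
have mG : measurable_fun setT G.
  apply: (measurable_fun_integral2 (lebesgue_rV R n) mHw) => p w; exact: H0.
have G0 p : 0 <= G p by apply: integral_ge0 => w _; exact: H0.
transitivity (\int[mu]_x \int[mu]_y G (a * x + enorm e' * y, x ^+ 2 + y ^+ 2)%R).
  rewrite [LHS]ge0_integral_rVS; last 2 first.
  - exact: mHd.
  - by move=> v; exact: H0.
  apply: eq_integral => x _.
  pose Hx (p : R * R) := H (a * x + p.1, x ^+ 2 + p.2)%R.
  have mHx : measurable_fun setT Hx by meas_comp mH.
  transitivity (\int[lebesgue_rV R n.+1]_v Hx (dot e' v, enorm v ^+ 2)%R).
    by apply: eq_integral => v _; rewrite eE dot_cons sqr_enorm_cons.
  rewrite IH; [|exact: mHx|by move=> p; exact: H0].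
  rewrite [LHS]ge0_integral_rVS; last 2 first.
  - apply: (measurableT_comp mHx); apply: measurable_fun_pair.
      by apply: measurable_funM => //; exact: (@measurable_coord_rV _ _ ord0).
    exact: measurable_sqr_enorm.
  - by move=> v; exact: H0.
  apply: eq_integral => y _; apply: eq_integral => w _.
  by rewrite /Hx /= sqr_enorm_cons cons_rV0 addrA.
rewrite [LHS](ge0_integral_rotation2 a (enorm e') mG G0) -nE.
rewrite [RHS]ge0_integral_rVS; last 2 first.
- exact: mHc.
- by move=> v; exact: H0.
apply: eq_integral => x _.
rewrite [RHS]ge0_integral_rVS; last 2 first.
- apply: (@measurable_fun_cons_rV2 _ _ (fun v => H (enorm e * v ord0 ord0, enorm v ^+ 2)%R)).
  exact: mHc.
- by move=> v; exact: H0.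
apply: eq_integral => y _; apply: eq_integral => w _.
by rewrite !sqr_enorm_cons cons_rV0 addrA.
Qed.

End rotation_rV.

(** * Integrals of derivatives *)

Section integral_of_derivative.
Context (R : realType).
Local Notation mu := (@lebesgue_measure R).

Lemma integral_is_derive (f F : R -> R) (a b : R) (b0 b1 : bool) : a < b ->
  measurable_fun setT f ->
  {in `[a, b], continuous f} -> {in `[a, b], forall x : R, is_derive x 1 F (f x)} ->
  (\int[mu]_(x in [set` Interval (BSide b0 a) (BSide b1 b)]) (f x)%:E =
   (F b - F a)%:E)%E.
Proof.
move=> ab mf cf dF.
rewrite integral_itv_bndoo; last first.
  by apply/measurable_EFinP; exact: measurable_funTS.
rewrite -(@integral_itv_bndoo _ a b _ true false); last first.
  by apply/measurable_EFinP; exact: measurable_funTS.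
have cF x : x \in `[a, b] -> {for x, continuous F}.
  move=> /dF dFx; apply: differentiable_continuous; apply/derivable1_diffP.
  exact: ex_derive.
rewrite (@continuous_FTC2 _ f F)//.
- apply: continuous_in_subspaceT => x /set_mem; exact: cf.
- split.
  + by move=> x /subset_itv_oo_cc xab; have := dF _ xab => dFx; exact: ex_derive.
  + by apply: cvg_at_right_filter; apply: cF; rewrite in_itv/= lexx ltW.
  + by apply: cvg_at_left_filter; apply: cF; rewrite in_itv/= lexx ltW.
- move=> x /subset_itv_oo_cc xab; have dFx := dF _ xab.
  by rewrite derive1E derive_val.
Qed.

Lemma integral_mul_indic d (T : measurableType d) (m : {measure set T -> \bar R})
    (A D : set T) (f : T -> R) :
  (\int[m]_(x in A) (f x * \1_D x)%:E = \int[m]_(x in A `&` D) (f x)%:E)%E.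
Proof.
rewrite integral_mkcondr; apply: eq_integral => x _; rewrite patchE indicE.
by case: ifPn => _; rewrite ?mulr1 ?mulr0.
Qed.

(** The mass of a ray under a density carried by the positive half-line, in the form that
    [measure_unique_ray] asks for. *)
Lemma integral_ray_indic (f F : R -> R) (b : R) :
  measurable_fun setT f -> continuous f -> (forall x : R, is_derive x 1 F (f x)) ->
  F 0 = 0 ->
  (\int[mu]_(x in `]-oo, b[) (f x * \1_(`]0%R, +oo[) x)%:E =
   (if 0 < b then F b else 0)%:E)%E.
Proof.
move=> mf cf dF F0; rewrite integral_mul_indic.
rewrite (_ : _ `&` _ = `]0, b[%classic); last first.
  apply/seteqP; split => x /=; rewrite !in_itv/= ?andbT; first by move=> [-> ->].
  by move=> /andP[-> ->].
case: ifPn => [b0|]; last first.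
  rewrite -leNgt => b0; rewrite set_itv_ge ?integral_set0//.
  by rewrite bnd_simp -leNgt.
by rewrite (@integral_is_derive _ F)// ?F0 ?subr0// => x _; exact: dF.
Qed.

End integral_of_derivative.

Lemma is_derive_mul_expr (R : realType) (c : R) n (r : R) :
  is_derive r 1 (fun r => c * r ^+ n.+1) (c * (n.+1%:R * r ^+ n)).
Proof.
rewrite (_ : (fun r => _) = c \*: (@id R ^+ n.+1)).
  by apply: is_derive_eq; rewrite /= [_ *: 1]mulr1.
by apply/funext => x; rewrite !fctE.
Qed.

Lemma continuous_mul_expr (R : realType) (c : R) n :
  continuous (fun r : R => c * (n.+1%:R * r ^+ n)).
Proof. by move=> r; apply: cvgMr; apply: cvgMr; exact: exprn_continuous. Qed.

(** The inverse is [x] times the power $-1$ of [x ^+ 2], a real power of a nonnegative number; at 0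
    both sides are 0 since [0^-1] is 0. *)
Lemma measurable_inv (R : realType) : measurable_fun setT (fun x : R => x^-1).
Proof.
rewrite (_ : (fun _ => _) = fun x : R => x * (x ^+ 2) `^ (-1)).
  apply: measurable_funM => //.
  by apply: (measurableT_comp (measurable_powR _)); exact: measurable_funX.
apply/funext => x; rewrite powR_inv1 ?sqr_ge0//.
by have [->|x0] := eqVneq x 0; [rewrite invr0 mul0r|field].
Qed.

(** * The law of the Euclidean norm *)

Section radial.
Context (R : realType).
Local Notation mu := (@lebesgue_measure R).

Definition ball_volume n : \bar R := lebesgue_rV R n [set v | enorm v < 1].

Lemma measurable_enorm_ray n (r : R) : measurable [set v : 'rV[R]_n | enorm v < r].
Proof.
rewrite (_ : [set v | _] = @enorm R n @^-1` `]-oo, r[%classic).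
  by rewrite -[X in measurable X]setTI; exact: measurable_enorm.
by apply/seteqP; split => v /=; rewrite in_itv.
Qed.

Lemma lebesgue_enorm_ray n (r : R) : 0 < r ->
  lebesgue_rV R n [set v | enorm v < r] = ((r ^+ n)%:E * ball_volume n)%E.
Proof.
move=> r0; have mB s := @measurable_enorm_ray n s.
rewrite /ball_volume -(setIT [set v | _]) -(setIT [set v | enorm v < 1]).
rewrite -!integral_indic// (@ge0_integral_rV_scale _ _ r)//.
- congr *%E; apply: eq_integral => v _; rewrite !indicE; congr (_%:R%:E).
  have vr : (enorm (r *: v) < r) = (enorm v < 1).
    by rewrite enormZ (gtr0_norm r0) -[X in _ < X]mulr1 ltr_pM2l.
  by congr nat_of_bool; apply/idP/idP; rewrite !inE/= vr.
- by apply/measurable_EFinP; exact: measurable_indic.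
Qed.

Lemma measurable_gauss_rV n :
  measurable_fun setT (fun v : 'rV[R]_n => (expR (- enorm v ^+ 2))%:E).
Proof.
apply/measurable_EFinP; apply: measurableT_comp => //.
by apply: measurable_funN; exact: measurable_sqr_enorm.
Qed.

(** The Gaussian is both radial and a product over the coordinates; computing its integral in these
    two ways gives the volume of the ball. *)
Lemma integral_gauss_rV n :
  (\int[lebesgue_rV R n]_v (expR (- enorm v ^+ 2))%:E = (Num.sqrt pi ^+ n)%:E)%E.
Proof.
elim: n => [|n IH].
  rewrite ge0_integral_rV0; first by rewrite enorm_rV0 expr0 expr0n oppr0 expR0.
  exact: measurable_gauss_rV.
rewrite ge0_integral_rVS; last 2 first.
- exact: measurable_gauss_rV.
- by move=> v; rewrite lee_fin expR_ge0.
under eq_integral => x _.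
  under eq_integral => v _ do rewrite sqr_enorm_cons opprD expRD EFinM.
  rewrite ge0_integralZl; last 4 first.
  - by [].
  - exact: measurable_gauss_rV.
  - by move=> v _; rewrite lee_fin expR_ge0.
  - by rewrite lee_fin expR_ge0.
  rewrite IH muleC; over.
rewrite ge0_integralZl; last 4 first.
- by [].
- by apply/measurable_EFinP; exact: measurable_gauss_fun.
- by move=> v _; rewrite lee_fin expR_ge0.
- by rewrite lee_fin exprn_ge0// sqrtr_ge0.
by rewrite [X in (_ * X)%E]integralT_gauss exprSr EFinM.
Qed.

(** On the unit ball the Gaussian is at least [expR (-1)], and its integral is finite. *)
Lemma ball_volume_fin_num n : ball_volume n \is a fin_num.
Proof.
rewrite ge0_fin_numE; last exact: measure_ge0.
have : ((expR (-1))%:E * ball_volume n < +oo)%E.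
  apply: (@le_lt_trans _ _ (Num.sqrt pi ^+ n)%:E); last exact: ltry.
  have mB := @measurable_enorm_ray n 1.
  rewrite -integral_gauss_rV /ball_volume -(setIT [set v | _]) -integral_indic//.
  rewrite -ge0_integralZl ?lee_fin ?expR_ge0//; last first.
    by apply/measurable_EFinP; exact: measurable_indic.
  apply: ge0_le_integral => //.
  - apply: emeasurable_funM => //.
    by apply/measurable_EFinP; exact: measurable_indic.
  - exact: measurable_gauss_rV.
  - move=> v _; rewrite -EFinM lee_fin indicE; case: (boolP (v \in _)) => [|_]; last first.
      by rewrite mulr0 expR_ge0.
    rewrite inE/= mulr1 ler_expR lerN2 => v1.
    by rewrite expr_le1 ?enorm_ge0// ltW.
have V0 : (0 <= ball_volume n)%E by exact: measure_ge0.
move: V0; case: (ball_volume n) => [r| |]; rewrite ?ltry// => _.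
by rewrite gt0_muley// lte_fin expR_gt0.
Qed.

End radial.

Section radial_law.
Context (R : realType).
Local Notation mu := (@lebesgue_measure R).

(** The derivative of the ball volume $V r^{n+1}$ for $r>0$: the index [n] belongs to dimension
    $n+1$. The factors are grouped as in [is_derive_mul_expr]. *)
Definition radial_weight n (r : R) : R :=
  fine (ball_volume R n.+1) * (n.+1%:R * r ^+ n) * \1_(`]0%R, +oo[%classic) r.

Lemma radial_weight_ge0 n r : 0 <= radial_weight n r.
Proof.
rewrite /radial_weight indicE; case: (boolP (r \in _)) => [|_]; last by rewrite mulr0.
rewrite inE/= in_itv/= andbT => r0; rewrite mulr1 !mulr_ge0//.
  by rewrite fine_ge0// measure_ge0.
by rewrite exprn_ge0// ltW.
Qed.

Lemma radial_weight_le0 n r : r <= 0 -> radial_weight n r = 0.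
Proof.
move=> r0; rewrite /radial_weight indicE memNset ?mulr0//= in_itv/= andbT.
by apply/negP; rewrite -leNgt.
Qed.

Lemma measurable_radial_weight n : measurable_fun setT (radial_weight n).
Proof.
apply: measurable_funM; last exact: measurable_indic.
by apply: measurable_funM => //; exact: measurable_funM.
Qed.

Let measurable_enormR n :
  measurable_fun setT (@enorm R n : 'rV[R]_n -> measurableTypeR R).
Proof. exact: measurable_enorm. Qed.

(** On the ray ending at $b>0$ both measures give the volume of the ball of radius $b$, by
    homogeneity on one side and by an antiderivative on the other. *)
Lemma enorm_distribution n (A : set R) : measurable A ->
  image_measure (lebesgue_rV R n.+1) (@measurable_enormR n.+1) A =
  density mu (measurable_radial_weight n) (@radial_weight_ge0 n) A.
Proof.
move=> mA; apply: (@measure_unique_ray R (image_measure (lebesgue_rV R n.+1) (@measurable_enormR n.+1))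
  (density mu (measurable_radial_weight n) (@radial_weight_ge0 n))) => // b.
all: have -> : image_measure (lebesgue_rV R n.+1) (@measurable_enormR n.+1) `]-oo, b[%classic =
   lebesgue_rV R n.+1 [set v | enorm v < b] by
  congr (lebesgue_rV R n.+1 _); apply/seteqP; split => v /=; rewrite in_itv.
- transitivity (\int[mu]_(r in `]-oo, b[) (radial_weight n r)%:E)%E; last by [].
  have dF := is_derive_mul_expr (fine (ball_volume R n.+1)) n.
  rewrite (integral_ray_indic b _ _ dF); last 3 first.
  + by apply: measurable_funM => //; exact: measurable_funM.
  + exact: continuous_mul_expr.
  + by rewrite expr0n mulr0.
  case: ifPn => b0.
    by rewrite lebesgue_enorm_ray// [in RHS]mulrC EFinM fineK// ball_volume_fin_num.
  rewrite (_ : [set v | _] = set0) ?measure0//.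
  apply/seteqP; split => v //= vb; case/negP: b0; exact: le_lt_trans (enorm_ge0 v) vb.
- have [b0|b0] := leP b 0.
    rewrite (_ : [set v | _] = set0) ?measure0//.
    apply/seteqP; split => v //= vb.
    by have := lt_le_trans (le_lt_trans (enorm_ge0 v) vb) b0; rewrite ltxx.
  rewrite lebesgue_enorm_ray// -ge0_fin_numE ?fin_numM ?ball_volume_fin_num//.
  by rewrite mule_ge0// ?measure_ge0// lee_fin exprn_ge0// ltW.
Qed.

Lemma ge0_integral_enorm n (h : R -> \bar R) :
  measurable_fun setT h -> (forall r, 0 <= h r)%E ->
  (\int[lebesgue_rV R n.+1]_v h (enorm v) =
   \int[mu]_r (h r * (radial_weight n r)%:E))%E.
Proof.
move=> mh h0.
rewrite -(ge0_integral_density mu (measurable_radial_weight n) (@radial_weight_ge0 n) mh h0).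
rewrite -(ge0_integral_image (lebesgue_rV R n.+1) (@measurable_enormR n.+1) mh h0).
by apply: eq_measure_integral => A mA _; exact: enorm_distribution.
Qed.

End radial_law.

Section sphere_area.
Context (R : realType).
Local Notation mu := (@lebesgue_measure R).

Let sqr_weight (r : R) : R := 1 * (2%:R * r ^+ 1) * \1_(`]0%R, +oo[%classic) r.

Let sqr_weight_ge0 r : 0 <= sqr_weight r.
Proof.
rewrite /sqr_weight indicE; case: (boolP (r \in _)) => [|_]; last by rewrite mulr0.
by rewrite inE/= in_itv/= andbT => r0; rewrite !mulr1 mul1r mulr_ge0// ltW.
Qed.

Let measurable_sqr_weight : measurable_fun setT sqr_weight.
Proof.
apply: measurable_funM; last exact: measurable_indic.
by apply: measurable_funM => //; exact: measurable_funM.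
Qed.

Let pos_weight (r : R) : R := 1 * (1%:R * r ^+ 0) * \1_(`]0%R, +oo[%classic) r.

Let pos_weight_ge0 r : 0 <= pos_weight r.
Proof. by rewrite /pos_weight !mulr1 mul1r. Qed.

Let measurable_pos_weight : measurable_fun setT pos_weight.
Proof.
apply: measurable_funM; last exact: measurable_indic.
by apply: measurable_funM => //; exact: measurable_funM.
Qed.

Let measurable_sqr :
  measurable_fun setT ((fun x => x ^+ 2) : measurableTypeR R -> measurableTypeR R).
Proof. exact: measurable_funX. Qed.

(** Under the density $2r$ on $r>0$, the set $r^2<b$ is the interval from 0 to $\sqrt b$, of mass
    $b$; so the image by squaring is Lebesgue measure on the half-line. This turns the Gamma
    integral into a Gaussian moment. *)
Lemma ge0_integral_sqr (h : R -> \bar R) :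
  measurable_fun setT h -> (forall r, 0 <= h r)%E ->
  (\int[mu]_(x in `]0%R, +oo[) h x =
   \int[mu]_(r in `]0%R, +oo[) (h (r ^+ 2)%R * (2 * r)%:E))%E.
Proof.
move=> mh h0.
transitivity (\int[mu]_x (h x * (pos_weight x)%:E))%E.
  rewrite integral_mkcond; apply: eq_integral => x _.
  rewrite patchE /pos_weight !mulr1 mul1r indicE.
  by case: ifPn => _; rewrite ?mule1 ?mule0.
transitivity (\int[mu]_r (h (r ^+ 2)%R * (sqr_weight r)%:E))%E; last first.
  rewrite [RHS]integral_mkcond; apply: eq_integral => x _.
  rewrite patchE /sqr_weight mul1r indicE.
  by case: ifPn => _; rewrite ?mulr1 ?mulr0 ?mule0.
rewrite -(ge0_integral_density mu measurable_pos_weight pos_weight_ge0 mh h0).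
have mh2 : measurable_fun setT (fun r : R => h (r ^+ 2)%R).
  by apply: (measurableT_comp mh); exact: measurable_funX.
rewrite -(ge0_integral_density mu measurable_sqr_weight sqr_weight_ge0 mh2) => [|//].
rewrite -(ge0_integral_image (density mu measurable_sqr_weight sqr_weight_ge0) measurable_sqr mh h0).
have E b : density mu measurable_pos_weight pos_weight_ge0 `]-oo, b[%classic =
    (if 0 < b then b else 0)%:E.
  transitivity (\int[mu]_(x in `]-oo, b[) (pos_weight x)%:E)%E; first by [].
  rewrite (integral_ray_indic b _ _ (is_derive_mul_expr 1 0)).
  - by rewrite mul1r expr1.
  - by apply: measurable_funM => //; exact: measurable_funM.
  - exact: continuous_mul_expr.
  - by rewrite mul1r expr1.
apply: eq_measure_integral => A mA _.
apply: (@measure_unique_ray R (density mu measurable_pos_weight pos_weight_ge0)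
  (image_measure (density mu measurable_sqr_weight sqr_weight_ge0) measurable_sqr)) => // b;
  rewrite E ?ltry//.
transitivity (\int[mu]_(x in (fun x => x ^+ 2)%R @^-1` `]-oo, b[) (sqr_weight x)%:E)%E; last by [].
rewrite integral_mul_indic; case: ifPn => b0; last first.
  rewrite (_ : _ `&` _ = set0) ?integral_set0//.
  apply/seteqP; split => x //= [+ _]; rewrite in_itv/= => xb.
  by case/negP: b0; exact: le_lt_trans (sqr_ge0 x) xb.
rewrite (_ : _ `&` _ = `]-oo, Num.sqrt b[ `&` `]0, +oo[)%classic; last first.
  apply/seteqP; split => x /=; rewrite !in_itv/= andbT => -[xb x0]; split => //.
    by rewrite -(ltr_pXn2r (n := 2)) ?nnegrE ?sqr_sqrtr ?sqrtr_ge0// ltW.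
  by rewrite -(ltr_pXn2r (n := 2)) ?nnegrE ?sqr_sqrtr ?sqrtr_ge0 ?ltW in xb.
rewrite -integral_mul_indic (integral_ray_indic _ _ _ (is_derive_mul_expr 1 1)).
- by rewrite sqrtr_gt0 b0 mul1r sqr_sqrtr// ltW.
- by apply: measurable_funM => //; exact: measurable_funM.
- exact: continuous_mul_expr.
- by rewrite mul1r expr0n.
Qed.

Let powR_half (p : R) n : 0 <= p -> p `^ (n%:R / 2) = Num.sqrt p ^+ n.
Proof.
by move=> p0; rewrite mulrC powRrM -powR12_sqrt// -powR_mulrn ?powR_ge0// div1r.
Qed.

Let gauss_moment n : \bar R :=
  (\int[mu]_(r in `]0%R, +oo[) (r ^+ n * expR (- r ^+ 2))%:E)%E.

Let measurable_moment n :
  measurable_fun setT (fun r : R => r ^+ n * expR (- r ^+ 2)).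
Proof.
apply: measurable_funM; first exact: measurable_funX.
by apply: measurableT_comp => //; apply: measurable_funN; exact: measurable_funX.
Qed.

Let gauss_moment_ball n : ((Num.sqrt pi ^+ n.+1)%:E =
  (fine (ball_volume R n.+1) * n.+1%:R)%:E * gauss_moment n)%E.
Proof.
have mh : measurable_fun setT (fun r : R => (expR (- r ^+ 2))%:E).
  by apply/measurable_EFinP; exact: measurable_gauss_fun.
rewrite -integral_gauss_rV.
rewrite (@ge0_integral_enorm _ n (fun r : R => (expR (- r ^+ 2))%:E)) => [|//|r]; last first.
  by rewrite lee_fin expR_ge0.
rewrite -ge0_integralZl//; last 3 first.
- by apply/measurable_EFinP; exact: (measurable_funTS (measurable_moment n)).
- move=> r; rewrite /= in_itv/= andbT => r0.
  by rewrite lee_fin mulr_ge0 ?expR_ge0// exprn_ge0// ltW.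
- by rewrite lee_fin mulr_ge0// fine_ge0// measure_ge0.
rewrite [RHS]integral_mkcond; apply: eq_integral => r _.
rewrite patchE /radial_weight indicE -!EFinM.
case: ifPn => _; last by rewrite !mulr0 ?mul0r.
by rewrite mulr1; congr EFin; ring.
Qed.

Let Gamma_gauss_moment n : Gamma (n.+1%:R / 2 : R) = fine (2%:E * gauss_moment n)%E.
Proof.
rewrite /Gamma /Rintegral; congr fine.
set h := fun x : R => (x `^ (n.+1%:R / 2 - 1) * expR (- x))%:E.
rewrite (@ge0_integral_sqr h); last 2 first.
- apply/measurable_EFinP; apply: measurable_funM; first exact: measurable_powR.
  by apply: measurableT_comp => //; exact: measurable_funN.
- by move=> r; rewrite lee_fin mulr_ge0 ?powR_ge0 ?expR_ge0.
rewrite -ge0_integralZl//; last 2 first.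
- by apply/measurable_EFinP; exact: (measurable_funTS (measurable_moment n)).
- move=> r; rewrite /= in_itv/= andbT => r0.
  by rewrite lee_fin mulr_ge0 ?expR_ge0// exprn_ge0// ltW.
apply: eq_integral => r; rewrite inE/= in_itv/= andbT => r0.
rewrite /h -!EFinM; congr EFin.
have -> : r ^+ n = (r ^+ 2) `^ (n.+1%:R / 2 - 1) * r.
  rewrite -{2}[r in RHS]powRr1 ?ltW// -(powR_mulrn 2) ?ltW// -powRrM.
  rewrite -powRD; last by rewrite (gt_eqF r0) implybT.
  by rewrite -powR_mulrn ?ltW//; congr powR; rewrite -natr1; field.
by ring.
Qed.

(** With $m=n+1$ and $J$ the moment of order $n$ of the Gaussian, polar integration gives
    $\pi^{m/2}=mV_mJ$, while $\Gamma(m/2)=2J$; eliminating $J$ yields the claim. *)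
Lemma sphere_area_ball_volume n :
  sphere_area R n.+1 = n.+1%:R * fine (ball_volume R n.+1).
Proof.
rewrite /sphere_area Gamma_gauss_moment powR_half ?pi_ge0//.
have pi_pos : 0 < Num.sqrt (pi : R) ^+ n.+1 by rewrite exprn_gt0// sqrtr_gt0 pi_gt0.
have V0 : 0 <= fine (ball_volume R n.+1) * n.+1%:R.
  by rewrite mulr_ge0// fine_ge0// measure_ge0.
have := gauss_moment_ball n.
have : (0 <= gauss_moment n)%E.
  apply: integral_ge0 => r; rewrite /= in_itv/= andbT => r0.
  by rewrite lee_fin mulr_ge0 ?expR_ge0// exprn_ge0// ltW.
(* An infinite moment would make the product infinite or zero, whereas it equals a finite positive
   power of $\pi^{1/2}$. *)
case: (gauss_moment n) => [J| |//] J0; last first.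
  have [V_gt0|V_le0] := ltP 0 (fine (ball_volume R n.+1) * n.+1%:R).
    by rewrite gt0_muley// lte_fin.
  by have -> : fine (ball_volume R n.+1) * n.+1%:R = 0;
    [apply/eqP; rewrite eq_le V_le0|rewrite mul0e => -[] /eqP; rewrite gt_eqF].
rewrite -EFinM => -[E]; rewrite /= E.
have J_neq0 : J != 0.
  by apply: contraTneq pi_pos => J_eq0; rewrite E J_eq0 mulr0 ltxx.
by field.
Qed.

End sphere_area.

(** * The law of the direction *)

Section cone_integral.
Context (R : realType).
Local Notation mu := (@lebesgue_measure R).
Local Open Scope ereal_scope.

Let ball_cutoff (p : R) : R := \1_(`]0%R, 1%R]%classic) p.

Let measurable_ball_cutoff : measurable_fun setT ball_cutoff.
Proof. exact: measurable_indic. Qed.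

Let integrand (g : R -> \bar R) (p : R * R) : \bar R :=
  g (p.1 / Num.sqrt p.2)%R * (ball_cutoff p.2)%:E.

Let measurable_inv_sqrt :
  measurable_fun setT (fun p : R * R => (Num.sqrt p.2)^-1)%R.
Proof.
have ms : measurable_fun setT (fun p : R * R => Num.sqrt p.2).
  apply: (@measurableT_comp _ _ _ _ _ _ (@Num.sqrt R)) => //.
  by apply: continuous_measurable_fun; exact: sqrt_continuous.
exact: (measurableT_comp (@measurable_inv R)).
Qed.

Let measurable_integrand g : measurable_fun setT g ->
  measurable_fun setT (integrand g).
Proof.
move=> mg; apply: emeasurable_funM.
  apply: (measurableT_comp mg); apply: measurable_funM => //.
by apply/measurable_EFinP; apply: (measurableT_comp measurable_ball_cutoff).
Qed.

Let integrand_ge0 g p : (forall u, 0 <= g u) -> 0 <= integrand g p.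
Proof. by move=> g0; rewrite /integrand mule_ge0// lee_fin /ball_cutoff indicE. Qed.

Lemma measurable_cone_integrand n (a : R) (g : R -> \bar R) :
  measurable_fun setT g ->
  measurable_fun setT (fun z : R => g (a * z / Num.sqrt (z ^+ 2 + 1))%R *
    (Num.sqrt (z ^+ 2 + 1) ^- n)%:E).
Proof.
move=> mg.
have mp : measurable_fun setT (fun z : R => (0, z ^+ 2 + 1) : R * R)%R.
  by apply: measurable_fun_pair => //; apply: measurable_funD => //; exact: measurable_funX.
have mS := measurableT_comp measurable_inv_sqrt mp.
apply: emeasurable_funM.
  apply: (measurableT_comp mg); apply: measurable_funM; last exact: mS.
  exact: measurable_funM.
apply/measurable_EFinP; under eq_fun do rewrite -exprVn.
by apply: measurable_funX; exact: mS.
Qed.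

(** After $v_0=rz$ and $|w|=r$ one has $|v|=r(z^2+1)^{1/2}$: the argument of [g] depends on $z$
    alone, and the ball becomes $r\le(z^2+1)^{-1/2}$. The integral of a multiple of $r^{n+1}$ up to
    this bound produces the power $-(n+2)$. *)
Lemma ge0_integral_cone n (e : 'rV[R]_n.+2) (g : R -> \bar R) :
  measurable_fun setT g -> (forall u, 0 <= g u) ->
  n.+2%:R%:E * \int[lebesgue_rV R n.+2]_(v in @punctured_ball R n.+2)
     g (dot e v / enorm v)%R =
  (sphere_area R n.+1)%:E *
  \int[mu]_z (g (enorm e * z / Num.sqrt (z ^+ 2 + 1))%R *
              (Num.sqrt (z ^+ 2 + 1) ^- n.+2)%:E).
Proof.
move=> mg g0; pose H := integrand g.
have mH : measurable_fun setT H by exact: measurable_integrand.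
have H0 p : 0 <= H p by exact: integrand_ge0.
have -> : \int[lebesgue_rV R n.+2]_(v in @punctured_ball R n.+2)
     g (dot e v / enorm v)%R =
    \int[lebesgue_rV R n.+2]_v H (dot e v, enorm v ^+ 2)%R.
  rewrite [LHS]integral_mkcond; apply: eq_integral => v _.
  rewrite patchE /H /integrand /= sqrtr_sqr ger0_norm ?enorm_ge0// /ball_cutoff indicE.
  have -> : ((enorm v ^+ 2)%R \in `]0%R, 1%R]%classic) = (v \in @punctured_ball R n.+2).
    apply/idP/idP; rewrite !inE/= in_itv/= /punctured_ball /=
      exprn_even_gt0//= lt_def enorm_ge0 andbT expr_le1 ?enorm_ge0//.
  by case: ifPn => _; rewrite ?mule1 ?mule0.
rewrite ge0_integral_rotation//.
have mHr (x : R) : measurable_fun setT (fun r : R => H (enorm e * x, x ^+ 2 + r ^+ 2)%R).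
  by meas_comp mH.
transitivity (n.+2%:R%:E * \int[mu]_x \int[mu]_r
    (H (enorm e * x, x ^+ 2 + r ^+ 2)%R * (radial_weight n r)%:E)).
  congr *%E; rewrite [LHS]ge0_integral_rVS; last 2 first.
  - apply: (measurableT_comp mH); apply: measurable_fun_pair.
      by apply: measurable_funM => //; exact: (@measurable_coord_rV _ _ ord0).
    exact: measurable_sqr_enorm.
  - by move=> v; exact: H0.
  apply: eq_integral => x _.
  rewrite -(ge0_integral_enorm n (mHr x)) => [|r]; last exact: H0.
  by apply: eq_integral => w _; rewrite sqr_enorm_cons cons_rV0.
rewrite [X in _ * X]tonelli_swapR; last 2 first.
- apply: emeasurable_funM; first by meas_comp mH.
  apply/measurable_EFinP; apply: (measurableT_comp (measurable_radial_weight n)).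
  exact: measurable_snd.
- by move=> x r; rewrite mule_ge0// lee_fin radial_weight_ge0.
transitivity (n.+2%:R%:E * \int[mu]_r \int[mu]_z
    (H (enorm e * (r * z), (r * z) ^+ 2 + r ^+ 2)%R * (radial_weight n r * r)%:E)).
  apply: (congr1 (fun u => n.+2%:R%:E * u)); apply: eq_integral => r _.
  (* [radial_weight] vanishes for $r\le0$, so the substitution $x=rz$ is performed only with a
     positive slope. *)
  have [r0|r0] := ltP 0%R r; last first.
    rewrite !integral0_eq// => x _; rewrite radial_weight_le0 ?mul0r ?mule0//.
  rewrite [LHS](@ge0_integral_affine _ r 0); last 3 first.
  - by rewrite gt_eqF.
  - apply: emeasurable_funM; first by meas_comp mH.
    exact: measurable_cst.
  - by move=> x; apply: mule_ge0; [exact: H0|rewrite lee_fin radial_weight_ge0].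
  rewrite -ge0_integralZl; last 4 first.
  - by [].
  - apply: emeasurable_funM; first by meas_comp mH.
    exact: measurable_cst.
  - move=> x _; apply: mule_ge0; first exact: H0. by rewrite lee_fin radial_weight_ge0.
  - by rewrite lee_fin.
  apply: eq_integral => z _.
  by rewrite addr0 (gtr0_norm r0) muleCA -EFinM [(r * radial_weight _ _)%R]mulrC.
rewrite [X in _ * X]tonelli_swapR; last 2 first.
- apply: emeasurable_funM; first by meas_comp mH.
  apply/measurable_EFinP; apply: measurable_funM; last exact: measurable_fst.
  by apply: (measurableT_comp (measurable_radial_weight n)); exact: measurable_fst.
- move=> r z; have [r0|r0] := ltP 0%R r; last first.
    by rewrite radial_weight_le0 ?mul0r ?mule0.
  by rewrite mule_ge0// lee_fin mulr_ge0 ?radial_weight_ge0// ltW.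
pose S (z : R) : R := Num.sqrt (z ^+ 2 + 1)%R.
have S_gt0 z : (0 < S z)%R by rewrite sqrtr_gt0 ltr_wpDl ?sqr_ge0.
(* For $r>0$ the weight times the Jacobian $r$ is [sphere_area R n.+1] times $r^{n+1}$, the
   derivative of $c\,r^{n+2}$; the denominator later cancels the factor [n.+2] of the surface
   measure. *)
pose c := (sphere_area R n.+1 / n.+2%:R)%R.
have c0 : (0 <= c)%R.
  by rewrite divr_ge0// sphere_area_ball_volume mulr_ge0// fine_ge0// measure_ge0.
have inner z : \int[mu]_r
    (H (enorm e * (r * z), (r * z) ^+ 2 + r ^+ 2)%R * (radial_weight n r * r)%:E) =
    c%:E * (g (enorm e * z / S z)%R * (S z ^- n.+2)%:E).
  transitivity (\int[mu]_r (g (enorm e * z / S z)%R *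
     (c * (n.+2%:R * r ^+ n.+1) * \1_(`]0%R, +oo[%classic) r *
       \1_(`]-oo, (S z)^-1%R]%classic) r)%:E)).
    apply: eq_integral => r _; have [r0|r0] := ltP 0%R r; last first.
      have -> : \1_(`]0%R, +oo[%classic) r = 0%R :> R.
        by rewrite indicE memNset//= in_itv/= andbT; apply/negP; rewrite -leNgt.
      by rewrite radial_weight_le0// mulr0 !mul0r !mule0.
    have pos : \1_(`]0%R, +oo[%classic) r = 1%R :> R.
      by rewrite indicE mem_set//= in_itv/= andbT.
    have rS : ((r * z) ^+ 2 + r ^+ 2 = (r * S z) ^+ 2)%R.
      by rewrite [in RHS]exprMn sqr_sqrtr ?addr_ge0 ?sqr_ge0//; ring.
    rewrite rS /H /integrand /= sqrtr_sqr ger0_norm ?mulr_ge0// ?ltW//.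
    rewrite -muleA -EFinM; congr (g _ * _%:E).
      by field; rewrite !gt_eqF.
    have -> : ball_cutoff ((r * S z) ^+ 2)%R = \1_(`]-oo, (S z)^-1%R]%classic) r.
      rewrite /ball_cutoff !indicE; congr (_ %:R)%R; congr nat_of_bool.
      have rS1 : ((r * S z) ^+ 2 <= 1)%R = (r <= (S z)^-1)%R.
        rewrite expr_le1 ?mulr_ge0 ?(ltW r0) ?(ltW (S_gt0 z))//.
        by rewrite -[((S z)^-1)%R]mul1r ler_pdivlMr.
      have rS0 : (0 < (r * S z) ^+ 2)%R by rewrite exprn_gt0// mulr_gt0.
      by apply/idP/idP; rewrite !inE/= !in_itv/= rS0 rS1.
    rewrite /radial_weight !pos !mulr1 /c sphere_area_ball_volume exprSr.
    by field.
  rewrite ge0_integralZl; last 4 first.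
  - by [].
  - apply/measurable_EFinP; apply: measurable_funM; last exact: measurable_indic.
    apply: measurable_funM; last exact: measurable_indic.
    by apply: measurable_funM => //; exact: measurable_funM.
  - move=> r _; rewrite lee_fin !indicE; case: (boolP (r \in `]0%R, +oo[%classic)) => [|_].
      rewrite inE/= in_itv/= andbT => r0.
      have rn : (0 <= r ^+ n.+1)%R by rewrite exprn_ge0// ltW.
      by rewrite mulr_ge0// mulr1 mulr_ge0// mulr_ge0.
    by rewrite mulr0 mul0r.
  - exact: g0.
  rewrite muleCA; congr (_ * _).
  rewrite integral_mul_indic setTI -integral_itv_bndo_bndc; last first.
    apply/measurable_EFinP; apply: measurable_funTS.
    apply: measurable_funM; last exact: measurable_indic.
    by apply: measurable_funM => //; exact: measurable_funM.
  rewrite (integral_ray_indic _ _ _ (is_derive_mul_expr c n.+1)).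
  - by rewrite invr_gt0 S_gt0 exprVn EFinM.
  - by apply: measurable_funM => //; exact: measurable_funM.
  - exact: continuous_mul_expr.
  - by rewrite expr0n mulr0.
under eq_integral do rewrite inner.
rewrite ge0_integralZl; last 4 first.
- by [].
- exact: measurable_cone_integrand.
- by move=> z _; rewrite mule_ge0// lee_fin invr_ge0 exprn_ge0// ltW.
- by rewrite lee_fin.
by rewrite muleA -EFinM mulrC /c divfK.
Qed.

End cone_integral.

(** * The substitution s |-> z *)

Section tangent_substitution.
Context (R : realType) (t : R).
Hypothesis t_gt1 : 1 < t.
Local Notation mu := (@lebesgue_measure R).

(* [s ^+ 2] ranges over the interval of center [mid_sq] and radius [rad_sq]
   when [s] ranges over ]1, t[. *)
Definition mid_sq : R := (t ^+ 2 + 1) / 2.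
Definition rad_sq : R := (t ^+ 2 - 1) / 2.

Let P (s : R) : R := (t ^+ 2 - s ^+ 2) * (s ^+ 2 - 1).

(** Put $u=(s^2-$[mid_sq]$)/$[rad_sq], which lies in ]-1, 1[. Then [P s] is [rad_sq ^+ 2] times
    $1-u^2$, and the formula reads $u/(1-u^2)^{1/2}$, the inverse of $z\mapsto z/(z^2+1)^{1/2}$. *)
Definition tangent_sub (s : R) : R := (s ^+ 2 - mid_sq) / Num.sqrt (P s).
Definition tangent_jac (s : R) : R := 2 * s * rad_sq ^+ 2 / (P s * Num.sqrt (P s)).
Definition tangent_inv (z : R) : R :=
  Num.sqrt (mid_sq + rad_sq * (z / Num.sqrt (z ^+ 2 + 1))).

Let rad_sq_gt0 : 0 < rad_sq.
Proof. by rewrite divr_gt0// subr_gt0 exprn_egt1. Qed.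

Let P_def s : P s = rad_sq ^+ 2 - (s ^+ 2 - mid_sq) ^+ 2.
Proof. by rewrite /P /rad_sq /mid_sq; field. Qed.

Let P_gt0 s : s \in `]1, t[ -> 0 < P s.
Proof.
rewrite in_itv/= => /andP[s1 st]; have s0 := lt_trans ltr01 s1.
rewrite /P mulr_gt0// subr_gt0; first by rewrite ltr_pXn2r// ?nnegrE ltW// (lt_trans s0).
by rewrite exprn_egt1.
Qed.

Let sqrtD1_gt0 (z : R) : 0 < Num.sqrt (z ^+ 2 + 1).
Proof. by rewrite sqrtr_gt0 ltr_wpDl ?sqr_ge0. Qed.

Lemma sqr_tangent_sub1 s : s \in `]1, t[ ->
  Num.sqrt (tangent_sub s ^+ 2 + 1) = rad_sq / Num.sqrt (P s).
Proof.
move=> /P_gt0 P0; have S0 : 0 < Num.sqrt (P s) by rewrite sqrtr_gt0.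
have -> : tangent_sub s ^+ 2 + 1 = (rad_sq / Num.sqrt (P s)) ^+ 2.
  rewrite /tangent_sub !exprMn exprVn sqr_sqrtr ?ltW//.
  rewrite -[X in _ + X](divff (lt0r_neq0 P0)) -mulrDl; congr (_ / _).
  by rewrite [X in _ + X]P_def /rad_sq /mid_sq; field.
by rewrite sqrtr_sqr ger0_norm// ltW// divr_gt0.
Qed.

Lemma tangent_sub_ratio s : s \in `]1, t[ ->
  tangent_sub s / Num.sqrt (tangent_sub s ^+ 2 + 1) = (s ^+ 2 - mid_sq) / rad_sq.
Proof.
move=> sI; have P0 := P_gt0 sI; have S0 : 0 < Num.sqrt (P s) by rewrite sqrtr_gt0.
have E (c S N : R) : c != 0 -> S != 0 -> N / S / (c / S) = N / c.
  by move=> c0 S1; field; rewrite c0 S1.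
by rewrite sqr_tangent_sub1// /tangent_sub E ?gt_eqF.
Qed.

Lemma tangent_subK s : s \in `]1, t[ -> tangent_inv (tangent_sub s) = s.
Proof.
move=> sI; have P0 := P_gt0 sI; have S0 : 0 < Num.sqrt (P s) by rewrite sqrtr_gt0.
rewrite /tangent_inv tangent_sub_ratio//.
rewrite mulrCA divff ?gt_eqF// mulr1 addrC subrK.
rewrite sqrtr_sqr ger0_norm//; move: sI; rewrite in_itv/= => /andP[s1 _].
by rewrite ltW// (lt_trans _ s1).
Qed.

Let range_tangent_inv z :
  1 < mid_sq + rad_sq * (z / Num.sqrt (z ^+ 2 + 1)) < t ^+ 2.
Proof.
have S0 := sqrtD1_gt0 z.
have /andP[u1 u2] : -1 < z / Num.sqrt (z ^+ 2 + 1) < 1.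
  rewrite -ltr_norml normrM normfV (gtr0_norm S0) ltr_pdivrMr// mul1r.
  by rewrite -sqrtr_sqr ltr_sqrt ?ltrDl// ltr_wpDl ?sqr_ge0.
have c0 := rad_sq_gt0.
have -> : t ^+ 2 = mid_sq + rad_sq by rewrite /mid_sq /rad_sq; field.
rewrite ltrD2l gtr_pMr// u2 andbT.
have e1 : mid_sq + rad_sq * -1 = 1 by rewrite /mid_sq /rad_sq; field.
by rewrite -[ltLHS]e1 ltrD2l ltr_pM2l.
Qed.

Let sqr_tangent_inv z : tangent_inv z ^+ 2 = mid_sq + rad_sq * (z / Num.sqrt (z ^+ 2 + 1)).
Proof.
have /andP[h _] := range_tangent_inv z.
by rewrite sqr_sqrtr// ltW// (lt_trans ltr01).
Qed.

Lemma tangent_inv_in z : tangent_inv z \in `]1, t[.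
Proof.
have := range_tangent_inv z; rewrite -sqr_tangent_inv => /andP[h1 h2].
have t0 : 0 <= t by rewrite ltW// (lt_trans ltr01).
have g0 : 0 <= tangent_inv z by exact: sqrtr_ge0.
have -> : tangent_inv z \in `]1, t[ = (1 < tangent_inv z) && (tangent_inv z < t).
  by rewrite in_itv.
rewrite -[1 < _]ltr_sqr ?nnegrE// -[_ < t]ltr_sqr ?nnegrE//.
by rewrite expr1n h1.
Qed.

Lemma tangent_invK z : tangent_sub (tangent_inv z) = z.
Proof.
have S0 := sqrtD1_gt0 z.
rewrite /tangent_sub P_def sqr_tangent_inv addrAC subrr add0r.
have E (c S : R) : S != 0 -> S ^+ 2 = z ^+ 2 + 1 ->
    c ^+ 2 - (c * (z / S)) ^+ 2 = (c / S) ^+ 2.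
  move=> S1 SE; have -> : c ^+ 2 - (c * (z / S)) ^+ 2 = c ^+ 2 * (S ^+ 2 - z ^+ 2) / S ^+ 2.
    by field.
  by rewrite -[LHS]/(_ / _) {1}SE addrAC subrr add0r mulr1 exprMn exprVn.
rewrite E ?gt_eqF// ?sqr_sqrtr ?addr_ge0 ?sqr_ge0//.
rewrite sqrtr_sqr ger0_norm; last by rewrite ltW// divr_gt0.
have E2 (c S : R) : c != 0 -> S != 0 -> c * (z / S) / (c / S) = z.
  by move=> c0 S1; field; rewrite c0 S1.
by rewrite E2 ?gt_eqF.
Qed.

Lemma tangent_jac_ge0 s : s \in `]1, t[ -> 0 <= tangent_jac s.
Proof.
move=> sI; have P0 := P_gt0 sI; move: sI; rewrite in_itv/= => /andP[s1 _].
have s0 := lt_trans ltr01 s1.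
rewrite /tangent_jac divr_ge0// mulr_ge0 ?sqr_ge0 ?sqrtr_ge0 ?(ltW P0)//.
by rewrite mulr_ge0// ltW.
Qed.

Let measurable_P : measurable_fun setT P.
Proof.
by apply: measurable_funM; apply: measurable_funB => //; exact: measurable_funX.
Qed.

Let measurable_sqrtP : measurable_fun setT (fun s => Num.sqrt (P s)).
Proof.
apply: (@measurableT_comp _ _ _ _ _ _ (@Num.sqrt R)) => //.
by apply: continuous_measurable_fun; exact: sqrt_continuous.
Qed.

Lemma measurable_tangent_sub : measurable_fun setT tangent_sub.
Proof.
apply: measurable_funM.
  by apply: measurable_funB => //; exact: measurable_funX.
exact: (measurableT_comp (@measurable_inv R)).
Qed.

Lemma measurable_tangent_jac : measurable_fun setT tangent_jac.
Proof.
apply: measurable_funM.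
  by apply: measurable_funM => //; exact: measurable_funM.
by apply: (measurableT_comp (@measurable_inv R)); exact: measurable_funM.
Qed.

Lemma is_derive_tangent_sub s : s \in `]1, t[ ->
  is_derive s 1 tangent_sub (tangent_jac s).
Proof.
move=> sI; have P0 := P_gt0 sI; have S0 : 0 < Num.sqrt (P s) by rewrite sqrtr_gt0.
have dP : is_derive s 1 P (- 4 * s * (s ^+ 2 - mid_sq)).
  rewrite (_ : P = (cst (t ^+ 2) - @id R ^+ 2) * (@id R ^+ 2 - cst 1)); last first.
    by apply/funext => x; rewrite !fctE.
  apply: is_derive_eq; rewrite !fctE /= expr1 /mid_sq /GRing.scale /=.
  by field.
have dS : is_derive s 1 (Num.sqrt \o P) ((2 * Num.sqrt (P s))^-1 * (- 4 * s * (s ^+ 2 - mid_sq))).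
  by apply: is_derive1_comp; exact: is_derive1_sqrt.
have dV := @is_deriveV _ _ s _ 1 (lt0r_neq0 S0) dS.
have dN : is_derive s 1 (fun s => s ^+ 2 - mid_sq) (2 * s).
  rewrite (_ : (fun _ => _) = @id R ^+ 2 - cst mid_sq); last first.
    by apply/funext => x; rewrite !fctE.
  by apply: is_derive_eq; rewrite /= expr1 /GRing.scale /= mulr1 subr0.
(* The quotient rule with numerator [N], denominator [S] and [c] equal to [rad_sq]; the relation
   between the three squares is [P_def]. *)
have E (N S c : R) : S != 0 -> c ^+ 2 = S ^+ 2 + N ^+ 2 ->
    N * (- S ^- 2 * ((2 * S)^-1 * (- 4 * s * N))) + S^-1 * (2 * s) =
    2 * s * c ^+ 2 / (S ^+ 2 * S).
  by move=> S1 ->; field.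
have := is_deriveM dN dV; move/is_derive_eq; apply.
rewrite /GRing.scale /= (E _ _ rad_sq) ?gt_eqF//; first by rewrite sqr_sqrtr ?ltW.
by rewrite sqr_sqrtr ?ltW// P_def subrK.
Qed.

Let weight (s : R) : R := tangent_jac s * \1_(`]1, t[%classic) s.

Let weight_ge0 s : 0 <= weight s.
Proof.
rewrite /weight indicE; case: (boolP (s \in `]1, t[%classic)) => [|_]; last by rewrite mulr0.
by rewrite inE/= mulr1; exact: tangent_jac_ge0.
Qed.

Let measurable_weight : measurable_fun setT weight.
Proof. by apply: measurable_funM; [exact: measurable_tangent_jac|exact: measurable_indic]. Qed.

Let integral_jac a b : a \in `]1, t[ -> b \in `]1, t[ -> a < b ->
  (\int[mu]_(s in `]a, b]) (tangent_jac s)%:E = (tangent_sub b - tangent_sub a)%:E)%E.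
Proof.
move=> aI bI ab.
have sub s : s \in `[a, b] -> s \in `]1, t[.
  move: aI bI; rewrite !in_itv/= => /andP[a1 _] /andP[_ bt] /andP[sa sb].
  by rewrite (lt_le_trans a1 sa) (le_lt_trans sb bt).
apply: integral_is_derive; first exact: ab.
- exact: measurable_tangent_jac.
- move=> s /sub sI; have P0 := P_gt0 sI.
  have cP : P x @[x --> s] --> P s.
    by apply: cvgM; apply: cvgB; try exact: cvg_cst; exact: exprn_continuous.
  apply: cvgM.
    by apply: cvgM; [apply: cvgMr|exact: cvg_cst].
  apply: cvgV; first by rewrite gt_eqF// mulr_gt0// sqrtr_gt0.
  apply: cvgM => //.
  by apply: (@continuous_comp _ _ _ P (@Num.sqrt R) s cP); exact: sqrt_continuous.
- by move=> s /sub; exact: is_derive_tangent_sub.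
Qed.

(** The increment is the integral of a nonnegative derivative, hence nonnegative; it is nonzero
    because [tangent_inv] is a left inverse. *)
Let tangent_sub_lt a b : a \in `]1, t[ -> b \in `]1, t[ -> a < b ->
  tangent_sub a < tangent_sub b.
Proof.
move=> aI bI ab; rewrite lt_neqAle; apply/andP; split.
  apply: contraTneq ab => /(congr1 tangent_inv); rewrite !tangent_subK// => ->.
  by rewrite ltxx.
rewrite -subr_ge0 -lee_fin -integral_jac//.
apply: integral_ge0 => s; rewrite /= lee_fin in_itv/= => /andP[sa sb].
apply: tangent_jac_ge0; move: aI bI; rewrite !in_itv/= => /andP[a1 _] /andP[_ bt].
by rewrite (lt_trans a1 sa) (le_lt_trans sb bt).
Qed.

Let lt_tangent_sub a b : a \in `]1, t[ -> b \in `]1, t[ ->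
  (tangent_sub a < tangent_sub b) = (a < b).
Proof.
move=> aI bI; apply/idP/idP; last exact: tangent_sub_lt.
by apply: contraTT; rewrite -!leNgt le_eqVlt => /predU1P[->//|ba];
  exact/ltW/tangent_sub_lt.
Qed.

Let measurable_sub : measurable_fun setT
  (tangent_sub : measurableTypeR R -> measurableTypeR R).
Proof. exact: measurable_tangent_sub. Qed.

(** The preimage of ]a, b] runs between the two values of [tangent_inv], which lie strictly inside
    ]1, t[, away from the singularities of the Jacobian; its mass is $b-a$. Rays would have infinite
    mass, so half-open intervals serve as the test sets. *)
Lemma ge0_integral_tangent_sub (phi : R -> \bar R) :
  measurable_fun setT phi -> (forall z, 0 <= phi z)%E ->
  (\int[mu]_z phi z =
   \int[mu]_(s in `]1%R, t[) (phi (tangent_sub s) * (tangent_jac s)%:E))%E.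
Proof.
move=> mphi phi0.
transitivity (\int[mu]_s (phi (tangent_sub s) * (weight s)%:E))%E; last first.
  rewrite [RHS]integral_mkcond; apply: eq_integral => s _.
  by rewrite patchE /weight indicE; case: ifPn => _; rewrite ?mulr1 ?mulr0 ?mule0.
rewrite -(ge0_integral_density mu measurable_weight weight_ge0
  (measurableT_comp mphi measurable_sub)) => [|s]; last exact: phi0.
rewrite -(ge0_integral_image (density mu measurable_weight weight_ge0)
  measurable_sub mphi phi0).
apply: eq_measure_integral => A mA _.
apply: (@lebesgue_measure_unique _ (image_measure
  (density mu measurable_weight weight_ge0) measurable_sub)) => // _ [[a b]] _ <-.
transitivity (\int[mu]_(s in tangent_sub @^-1` `]a, b]) (weight s)%:E)%E; last by [].
rewrite integral_mul_indic.
rewrite (_ : _ `&` _ = `]tangent_inv a, tangent_inv b]%classic); last first.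
  have aI := tangent_inv_in a; have bI := tangent_inv_in b.
  have mem s : s \in `]1, t[ -> (s \in `]tangent_inv a, tangent_inv b]) =
      (tangent_sub s \in `]a, b]).
    move=> sI; rewrite !in_itv/= -lt_tangent_sub// tangent_invK; congr andb.
    by rewrite !leNgt -lt_tangent_sub// tangent_invK.
  apply/seteqP; split => s /=; first by move=> [sab sI]; rewrite mem.
  move=> sab; suff sI : s \in `]1, t[ by split => //; rewrite -mem.
  move: aI bI sab; rewrite !in_itv/= => /andP[a1 _] /andP[_ bt] /andP[sa sb].
  by rewrite (lt_trans a1 sa) (le_lt_trans sb bt).
rewrite lebesgue_measure_itv/= lte_fin; case: ifPn => ab.
  rewrite integral_jac ?tangent_inv_in ?tangent_invK ?EFinB//.
  by rewrite -lt_tangent_sub ?tangent_inv_in// !tangent_invK.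
rewrite set_itv_ge ?integral_set0// bnd_simp -leNgt.
by rewrite leNgt -lt_tangent_sub ?tangent_inv_in// !tangent_invK.
Qed.

End tangent_substitution.

(** * Completions *)

Section completion_transfer.
Context d d' (T : measurableType d) (T' : measurableType d') (R : realType).
Variables (m : {measure set T -> \bar R}) (m' : {measure set T' -> \bar R}).
Variables (phi : T' -> T) (mphi : measurable_fun setT phi).
Hypothesis m'E : forall A, measurable A -> m' (phi @^-1` A) = m A.
Hypothesis cm' : measure_is_complete m'.
Variables (D N : set T) (f : T' -> \bar R) (g : T -> \bar R).
Hypotheses (mD : measurable D) (mN : measurable N) (N0 : m N = 0%E).
Hypothesis mg : measurable_fun setT g.
Hypothesis fg : forall x, D (phi x) -> ~ N (phi x) -> f x = g (phi x).
Local Open Scope ereal_scope.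

Let mpre A : measurable A -> measurable (phi @^-1` A).
Proof. by move=> mA; rewrite -[X in measurable X]setTI; exact: mphi. Qed.

Let ae_fg : ae_eq m' (phi @^-1` D) (g \o phi) f.
Proof.
exists (phi @^-1` N); split; [exact: mpre|by rewrite m'E|].
by move=> x /= /not_implyP[Dx gf]; apply: contrapT => /(fg Dx)/esym.
Qed.

Let measurable_gphi : measurable_fun (phi @^-1` D) (g \o phi).
Proof. by apply: measurable_funTS; exact: measurableT_comp. Qed.

(** Completeness of [m'] enters here: [f] agrees with a measurable function off a null set. *)
Let measurable_f : measurable_fun (phi @^-1` D) f.
Proof. exact: (ae_measurable_fun cm' ae_fg measurable_gphi). Qed.

Let integral_imageE (h : T -> \bar R) :
  \int[image_measure m' mphi]_(x in D) h x = \int[m]_(x in D) h x.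
Proof. by apply: eq_measure_integral => A mA _; exact: m'E. Qed.

Let integral_abse : \int[m']_(x in phi @^-1` D) `|f x| = \int[m]_(x in D) `|g x|.
Proof.
transitivity (\int[m']_(x in phi @^-1` D) `|g (phi x)|).
  apply: ge0_ae_eq_integral => //.
  - exact: mpre.
  - by apply: measurableT_comp => //; exact: measurable_f.
  - by apply: measurableT_comp => //; exact: measurable_gphi.
  - by apply: ae_eq_abse; exact: ae_eq_sym.
rewrite -integral_imageE [RHS](ge0_integral_pushforward mphi m' mD)//.
by apply: measurable_funTS; apply: measurableT_comp.
Qed.

(** In its applications [phi] is the identity from a completed sigma-algebra to the original one,
    kept as a map because the two sides carry different measurable structures. *)
Lemma completion_integrable :
  m'.-integrable (phi @^-1` D) f <-> m.-integrable D g.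
Proof.
split=> /integrableP[_ h]; apply/integrableP.
  by split; [exact: measurable_funTS|rewrite -integral_abse].
by split; [exact: measurable_f|rewrite integral_abse].
Qed.

Lemma completion_integral : m.-integrable D g ->
  \int[m']_(x in phi @^-1` D) f x = \int[m]_(x in D) g x.
Proof.
move=> ig; transitivity (\int[m']_(x in phi @^-1` D) (g \o phi) x).
  apply: ae_eq_integral; first exact: mpre.
  - exact: measurable_f.
  - exact: measurable_gphi.
  - exact: ae_eq_sym.
rewrite -integral_imageE (integral_pushforward mphi mg _ mD)//.
have /integrableP[_ h] := ig; apply/integrableP; split => //.
suff -> : \int[m']_(x in phi @^-1` D) `|(g \o phi) x| = \int[m]_(x in D) `|g x| by [].
rewrite -[RHS]integral_imageE [RHS](ge0_integral_pushforward mphi m' mD)//.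
by apply: measurable_funTS; apply: measurableT_comp.
Qed.

End completion_transfer.

Section borel_version.
Context (R : realType).
Local Notation mu := (@lebesgue_measure R).
Local Notation completedR := (caratheodory_type ((wlength (@idfun R))^*)%mu).

Lemma completed_measurable_borel (A : set R) : measurable (A : set completedR) ->
  exists B N : set R, [/\ measurable B, measurable N, mu N = 0%E, B `<=` A &
    A `<=` B `|` N].
Proof.
move=> mA.
have : ((wlength (@idfun R))^*%mu).-cara.-measurable A by [].
rewrite -completed_caratheodory_measurable g_sigma_completed_algebra_genE.
move=> [B mB [M [N [mN N0 MN]] <-]]; exists B, N; split => //.
by apply: setUS.
Qed.

(** For each rational level, the sublevel set of [f] contains a Borel set and exceeds it only inside
    a Borel null set. Off the countable union of these null sets, every sublevel set is a union of
    the Borel ones over smaller rational levels. *)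
Lemma borel_version (D : set R) (f : R -> R) : measurable D ->
  measurable_fun (D : set completedR) (f : completedR -> R) ->
  exists (g : R -> R) (N : set R), [/\ measurable_fun setT g, measurable N,
    mu N = 0%E & forall x, D x -> ~ N x -> f x = g x].
Proof.
move=> mD mf.
have mDc : measurable (D : set completedR) by exact: sub_caratheodory.
(* An enumeration of the rationals; the default 0, for indices that code no rational, merely repeats
   a level. *)
pose r_ (i : nat) : R := ratr (odflt 0 (unpickle i)).
have r_dense x y : x < y -> exists i, x < r_ i < y.
  move=> /rat_in_itvoo[q]; rewrite in_itv/= => xqy.
  by exists (pickle q); rewrite /r_ pickleK.
pose A i := D `&` [set x | f x < r_ i].
have mA i : measurable (A i : set completedR).
  have := mf mDc `]-oo, (r_ i)[%classic.
  rewrite (_ : _ `&` _ = A i); first by apply; exact: measurable_itv.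
  by apply/seteqP; split => x /=; rewrite in_itv.
have /choice[BN HBN] i : exists BN : set R * set R,
    [/\ measurable BN.1, measurable BN.2, mu BN.2 = 0%E, BN.1 `<=` A i &
      A i `<=` BN.1 `|` BN.2].
  by have [B [N H]] := completed_measurable_borel (mA i); exists (B, N).
pose N := \bigcup_i (BN i).2.
have mN : measurable N by apply: bigcupT_measurable => i; have [] := HBN i.
have N0 : mu N = 0%E.
  apply: measure_negligible => //; apply: negligible_bigcup => i.
  by have [_ mNi Ni0 _ _] := HBN i; exists (BN i).2; split.
pose DN := D `\` N.
have mDN : measurable DN by exact: measurableD.
pose g (x : R) := if x \in DN then f x else 0.
exists g, N; split => //; last by move=> x Dx Nx; rewrite /g mem_set.
apply: (measurability _ (RGenInftyO.measurableE R)) => // _ [_ [r ->] <-].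
rewrite setTI (_ : _ @^-1` _ =
  (DN `&` \bigcup_(i in [set i | r_ i < r]) (BN i).1) `|`
  (~` DN `&` (if 0 < r then setT else set0))); last first.
  apply/seteqP; split => x /=; rewrite in_itv/= /g.
    case: ifPn => [|xDN].
      rewrite inE => xDN fxr; left; split => //.
      have [i /andP[fi ir]] := r_dense _ _ fxr; exists i => //.
      have [_ _ _ _ /(_ x)[]] := HBN i; [by split => //; case: xDN|by []|].
      by move=> BNx; case: xDN => _ []; exists i.
    move=> r0; right; rewrite r0; split => // DNx.
    by case/negP: xDN; rewrite inE.
  move=> [[xDN [i /= ir Bx]]|[xDN]].
    rewrite mem_set//; apply: lt_trans ir.
    by have [_ _ _ /(_ x Bx)[]] := HBN i.
  by rewrite memNset//; case: (0 < r) => // -[].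
apply: measurableU; apply: measurableI => //.
- by apply: bigcup_measurable => i _; have [] := HBN i.
- exact: measurableC.
- by case: ifPn.
Qed.

End borel_version.

(** * The tangent sphere *)

Section tangent_sphere_geometry.
Context (R : realType).

Lemma sqr_enorm_mx n (v : 'rV[R]_n) : enorm v ^+ 2 = (v *m v^T) ord0 ord0.
Proof. by rewrite sqr_enorm mxE; apply: eq_bigr => i _; rewrite mxE expr2. Qed.

Lemma sqr_enormDZ n (u v : 'rV[R]_n) (c : R) :
  enorm (u + c *: v) ^+ 2 = enorm u ^+ 2 + 2 * c * dot u v + c ^+ 2 * enorm v ^+ 2.
Proof.
rewrite !sqr_enorm /dot !mulr_sumr -!big_split/=.
by apply: eq_bigr => i _; rewrite !mxE; ring.
Qed.

Lemma enorm_mul_orthonormal k n (B : 'M[R]_(k, n)) (v : 'rV[R]_k) :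
  B *m B^T = 1%:M -> enorm (v *m B) = enorm v.
Proof.
move=> BB; apply/eqP; rewrite -(eqrXn2 (n := 2)) ?enorm_ge0//.
by rewrite !sqr_enorm_mx trmx_mul mulmxA -[v *m B *m _]mulmxA BB mulmx1.
Qed.

(** The law of cosines: for $t=2|e|-1$, [mid_sq t] is $|e|^2+(|e|-1)^2$. *)
Lemma enorm_tangent_sphere k n (B : 'M[R]_(k, n)) (e v : 'rV[R]_k) :
  B *m B^T = 1%:M -> 0 < enorm v ->
  enorm (e *m B + (enorm e - 1) *: radial_proj B v) =
  Num.sqrt (mid_sq (2 * enorm e - 1) + 2 * (enorm e - 1) * (dot e v / enorm v)).
Proof.
move=> BB v0; rewrite /radial_proj scalerA [_ *: (v *m B)]scalemxAl -mulmxDl.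
rewrite enorm_mul_orthonormal// -[LHS](ger0_norm (enorm_ge0 _)) -sqrtr_sqr.
congr Num.sqrt; rewrite sqr_enormDZ /mid_sq; field.
by rewrite gt_eqF.
Qed.

(** Orthonormal rows are free, and [\dim xi] free vectors of [xi] span it. *)
Lemma orthonormal_frame_span n (xi : {vspace 'rV[R]_n}) (x : 'rV[R]_n) :
  x \in xi -> exists e : 'rV[R]_(\dim xi), x = e *m orthonormal_frame xi.
Proof.
move=> xxi; have [BB Bxi] := orthonormal_frameP xi.
set B := orthonormal_frame xi in BB Bxi *.
pose X := [tuple row i B | i < \dim xi].
have freeX : free X.
  apply/freeP => k k0 i; have : (\row_j k j) *m B = 0.
    rewrite mulmx_sum_row -[RHS]k0; apply: eq_bigr => j _.
    by rewrite mxE (nth_mktuple).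
  move=> /(congr1 (mulmx^~ B^T)); rewrite -mulmxA BB mulmx1 mul0mx.
  by move=> /rowP/(_ i); rewrite !mxE.
have spanX : <<X>>%VS = xi.
  apply/eqP; rewrite eqEdim; apply/andP; split.
    by apply/span_subvP => _ /mapP[i _ ->]; exact: Bxi.
  by move: freeX; rewrite /free => /eqP ->; rewrite size_tuple.
rewrite -spanX in xxi; have := coord_span xxi => xE.
exists (\row_j coord X j x); rewrite mulmx_sum_row [LHS]xE.
by apply: eq_bigr => j _; rewrite mxE nth_mktuple.
Qed.

Lemma mem_mul_frame n (xi : {vspace 'rV[R]_n}) (v : 'rV[R]_(\dim xi)) :
  v *m orthonormal_frame xi \in xi.
Proof.
have [_ Bxi] := orthonormal_frameP xi.
by rewrite mulmx_sum_row rpred_sum// => i _; rewrite memvZ.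
Qed.

Lemma enorm_eq0 n (v : 'rV[R]_n) : (enorm v == 0) = (v == 0).
Proof.
apply/eqP/eqP => [v0|->]; last first.
  by rewrite /enorm big1 ?sqrtr0// => i _; rewrite mxE expr0n.
have : enorm v ^+ 2 = 0 by rewrite v0 expr0n.
rewrite sqr_enorm => /eqP; rewrite psumr_eq0 => [|i _]; last exact: sqr_ge0.
move=> /allP h; apply/rowP => i; have := h i (mem_index_enum i).
by rewrite mxE /= sqrf_eq0 => /eqP.
Qed.

End tangent_sphere_geometry.

(** * The density of the distance on the tangent sphere *)

Section tangent_weight.
Context (R : realType).

(** The first power is the kernel of $F_-$, the second is the factor that turns $f_0$ into $f_1$. *)
Definition tangent_exponent (k : nat) (s t : R) : R :=
  (t ^+ 2 - s ^+ 2) `^ ((k%:R - 3) / 2) * (s ^+ 2 - 1) `^ ((k%:R - 3) / 2).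

Definition tangent_weight (k : nat) (t s : R) : R :=
  2 * rad_sq t `^ (2 - k%:R) * (tangent_exponent k s t * s).

(** With $P=(t^2-s^2)(s^2-1)$ and $c$ for [rad_sq t], the first factor is $(P^{1/2}/c)^k$ and the
    Jacobian is $2sc^2/P^{3/2}$; their product $2c^{2-k}P^{(k-3)/2}s$ explains both exponents in the
    theorem. *)
Lemma tangent_jacE (k : nat) (t s : R) : 1 < t -> s \in `]1, t[ ->
  (Num.sqrt (tangent_sub t s ^+ 2 + 1) ^- k) * tangent_jac t s = tangent_weight k t s.
Proof.
move=> t1 sI; rewrite sqr_tangent_sub1//.
have : 0 < rad_sq t by rewrite divr_gt0// subr_gt0 exprn_egt1.
move: sI; rewrite in_itv/= => /andP[s1 st].
have s0 : 0 < s by rewrite (lt_trans ltr01).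
have ts : 0 < t ^+ 2 - s ^+ 2 by rewrite subr_gt0 ltr_sqr// nnegrE ltW// (lt_trans s0).
have s2 : 0 < s ^+ 2 - 1 by rewrite subr_gt0 exprn_egt1.
rewrite /tangent_jac /tangent_weight /tangent_exponent -powRM ?ltW//.
set P := (t ^+ 2 - s ^+ 2) * (s ^+ 2 - 1); set c := rad_sq t => c0.
have P0 : 0 < P by rewrite mulr_gt0.
have S0 : 0 < Num.sqrt P by rewrite sqrtr_gt0.
have cE : c `^ (2 - k%:R) = c ^+ 2 / c ^+ k.
  apply: (mulIf (x := c ^+ k)); first by rewrite expf_neq0// gt_eqF.
  rewrite divfK ?expf_neq0 ?gt_eqF// -!powR_mulrn ?ltW// -powRD.
    by rewrite subrK.
  by rewrite (gt_eqF c0) implybT.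
have PE : P `^ ((k%:R - 3) / 2) = Num.sqrt P ^+ k / (P * Num.sqrt P).
  have -> : P * Num.sqrt P = Num.sqrt P ^+ 3.
    by rewrite -{1}[P]sqr_sqrtr ?ltW// -exprSr.
  apply: (mulIf (x := Num.sqrt P ^+ 3)); first by rewrite expf_neq0// gt_eqF.
  rewrite divfK ?expf_neq0 ?gt_eqF// -!(powR_mulrn _ (ltW S0)) -powR12_sqrt ?ltW//.
  rewrite -!powRrM -powRD; last by rewrite (gt_eqF P0) implybT.
  by congr powR; field.
rewrite cE PE exprMn exprVn; field.
by rewrite !expf_neq0 ?gt_eqF.
Qed.

End tangent_weight.

Section tangent_cone.
Context (R : realType).
Local Notation mu := (@lebesgue_measure R).
Local Open Scope ereal_scope.

Lemma ge0_integral_tangent_cone k n (B : 'M[R]_(k, n)) (e : 'rV[R]_k)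
    (phi : R -> \bar R) : (2 <= k)%N -> B *m B^T = 1%:M -> (1 < enorm e)%R ->
  measurable_fun setT phi -> (forall s, 0 <= phi s) ->
  let t := (2 * enorm e - 1)%R in
  k%:R%:E * \int[lebesgue_rV R k]_(v in @punctured_ball R k)
    phi (enorm (e *m B + (enorm e - 1) *: radial_proj B v)%R) =
  (sphere_area R k.-1)%:E *
  \int[mu]_(s in `]1%R, t[) (phi s * (tangent_weight k t s)%:E).
Proof.
case: k B e => [//|[//|k]] B e _ BB e1 mphi phi0 t.
have t1 : (1 < t)%R by rewrite /t; lra.
pose g (u : R) := phi (Num.sqrt (mid_sq t + 2 * (enorm e - 1) * u)).
have mg : measurable_fun setT g.
  apply: (measurableT_comp mphi).
  apply: (@measurableT_comp _ _ _ _ _ _ (@Num.sqrt R)).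
    by apply: continuous_measurable_fun; exact: sqrt_continuous.
  by apply: measurable_funD => //; exact: measurable_funM.
transitivity (k.+2%:R%:E * \int[lebesgue_rV R k.+2]_(v in @punctured_ball R k.+2)
    g (dot e v / enorm v)%R).
  apply: (congr1 (fun u => k.+2%:R%:E * u)); apply: eq_integral => v.
  rewrite inE /punctured_ball /= => /andP[v0 _].
  by rewrite enorm_tangent_sphere.
rewrite ge0_integral_cone//; last by move=> u; exact: phi0.
apply: (congr1 (fun u => (sphere_area R k.+1)%:E * u)).
rewrite (ge0_integral_tangent_sub t1); last 2 first.
- exact: measurable_cone_integrand.
- by move=> z; rewrite mule_ge0// ?phi0// lee_fin invr_ge0 exprn_ge0// sqrtr_ge0.
apply: eq_integral => s; rewrite inE/= => sI.
rewrite -muleA -EFinM tangent_jacE//; congr (phi _ * _).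
have s0 : (0 < s)%R by move: sI; rewrite in_itv/= => /andP[s1 _]; exact: lt_trans s1.
have rad0 : (0 < rad_sq t)%R by rewrite divr_gt0// subr_gt0 exprn_egt1.
rewrite -[(enorm e * _ / _)%R]mulrA tangent_sub_ratio// [(_ * (enorm e * _))%R]mulrA.
(* The choice $t=2|e|-1$ makes the amplitude equal to [rad_sq t], so the expression under the root
   collapses to $s^2$. *)
have -> : (2 * (enorm e - 1) * enorm e = rad_sq t)%R by rewrite /rad_sq /t; field.
rewrite mulrCA divff ?gt_eqF// mulr1 addrC subrK sqrtr_sqr ger0_norm//.
exact: ltW.
Qed.

End tangent_cone.

(** * Surface integrals of functions of the distance *)

Section surface_integral.
Context (R : realType) (n : nat).
Local Notation mu := (@lebesgue_measure R).
Local Open Scope ereal_scope.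

Lemma ge0_integral_surface (xi : {vspace 'rV[R]_n}) (psi : 'rV[R]_n -> \bar R) :
  measurable_fun setT psi -> (forall th, 0 <= psi th) ->
  \int[surface_measure xi]_th psi th =
  (\dim xi)%:R%:E * \int[lebesgue_rV R (\dim xi)]_(v in @punctured_ball R (\dim xi))
    psi (radial_proj (orthonormal_frame xi) v).
Proof.
move=> mpsi psi0; set k := \dim xi; set B := orthonormal_frame xi.
pose w (v : 'rV[R]_k) : R := \1_(@punctured_ball R k) v.
have mball := @measurable_punctured_ball R k.
have mw : measurable_fun setT w by exact: measurable_indic.
have w0 v : (0 <= w v)%R by [].
have mB := @measurable_radial_proj R n k B.
pose m := mscale (NngNum (ler0n R k)) (image_measure (density (lebesgue_rV R k) mw w0) mB).
transitivity (\int[m]_th psi th).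
  apply: eq_measure_integral => A mA _.
  transitivity (k%:R%:E * \int[lebesgue_rV R k]_(v in radial_proj B @^-1` A) (w v)%:E); last by [].
  rewrite /surface_measure -/k -/B integral_indic//; first by rewrite setIC.
  by rewrite -[X in measurable X]setTI; exact: (@measurable_radial_proj R n k B).
rewrite ge0_integral_mscale//; congr (_ * _).
rewrite ge0_integral_image// ge0_integral_density//; last exact: (measurableT_comp mpsi mB).
rewrite [RHS]integral_mkcond; apply: eq_integral => v _.
by rewrite patchE /w indicE; case: ifPn => _; rewrite ?mule1 ?mule0.
Qed.

(** The radial projection sends every point of the punctured ball to the sphere. Integrals over the
    sphere and over the whole space can thus be exchanged. *)
Lemma surface_measure_unit_sphereC (xi : {vspace 'rV[R]_n}) :
  surface_measure xi (~` unit_sphere xi) = 0.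
Proof.
have [BB Bxi] := orthonormal_frameP xi.
rewrite /surface_measure (_ : _ `&` _ = set0) ?measure0 ?mule0//.
apply/seteqP; split => v //= [nS /andP[v0 _]]; apply: nS.
rewrite /radial_proj; split.
  rewrite enormZ enorm_mul_orthonormal// ger0_norm ?invr_ge0 ?enorm_ge0//.
  by rewrite mulVf// gt_eqF.
by rewrite memvZ// mem_mul_frame.
Qed.

(** Membership in [xi] is expressed by the orthogonal projection [B^T *m B] fixing the vector, a
    condition on measurable functions of the coordinates. *)
Lemma measurable_unit_sphere (xi : {vspace 'rV[R]_n}) :
  measurable (unit_sphere xi).
Proof.
have [BB Bxi] := orthonormal_frameP xi; set B := orthonormal_frame xi in BB Bxi.
have mB : measurable_fun setT (fun th : 'rV[R]_n => enorm (th - th *m (B^T *m B))).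
  apply: measurableT_comp; first exact: measurable_enorm.
  apply: measurable_fun_rV => i.
  rewrite (_ : _ \o _ = fun th => coord_rV i th -
    \sum_j coord_rV j th * (B^T *m B) j i)%R; last first.
    by apply/funext => th; rewrite /coord_rV /= !mxE; congr (_ - _)%R;
      apply: eq_bigr => j _; rewrite !mxE.
  apply: measurable_funB; first exact: measurable_coord_rV.
  by apply: measurable_sum => j; apply: measurable_funM => //; exact: measurable_coord_rV.
rewrite (_ : unit_sphere xi = @enorm R n @^-1` [set 1%R] `&`
  (fun th => enorm (th - th *m (B^T *m B))) @^-1` [set 0%R]).
  apply: measurableI; rewrite -[X in measurable X]setTI.
    by apply: measurable_enorm => //; exact: measurable_set1.
  by apply: mB => //; exact: measurable_set1.
apply/seteqP; split => th; rewrite /unit_sphere /=.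
  move=> [-> thxi]; split => //.
  have [e ->] := orthonormal_frame_span thxi.
  apply/eqP; rewrite enorm_eq0 -/B mulmxA -[e *m B *m _]mulmxA BB mulmx1.
  by rewrite subrr.
move=> [-> /eqP]; rewrite enorm_eq0 subr_eq0 => /eqP ->; split => //.
by rewrite mulmxA mem_mul_frame.
Qed.

End surface_integral.

Section tangent_mean_formula.
Context (R : realType) (n : nat) (xi : {vspace 'rV[R]_n}) (x : 'rV[R]_n).
Hypotheses (dim_xi : (2 <= \dim xi)%N) (x_xi : x \in xi) (x_gt1 : 1 < enorm x).
Local Notation mu := (@lebesgue_measure R).
Local Notation k := (\dim xi).
Local Notation t := (2 * enorm x - 1).

Definition tangent_dist (th : 'rV[R]_n) : R := enorm (x + (enorm x - 1) *: th).

Lemma measurable_tangent_dist : measurable_fun setT tangent_dist.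
Proof.
apply: measurableT_comp; first exact: measurable_enorm.
apply: measurable_fun_rV => i.
rewrite (_ : _ \o _ = fun th => x ord0 i + (enorm x - 1) * coord_rV i th); last first.
  by apply/funext => th; rewrite /coord_rV /= !mxE.
apply: measurable_funD => //; apply: measurable_funM => //.
exact: measurable_coord_rV.
Qed.

Let t_gt1 : 1 < t. Proof. by have := x_gt1; lra. Qed.

Let itv_sub s : s \in `]1, t[ -> [/\ 0 < s, 0 < t ^+ 2 - s ^+ 2 & 0 < s ^+ 2 - 1].
Proof.
rewrite in_itv/= => /andP[s1 st]; have s0 : 0 < s by rewrite (lt_trans ltr01).
split=> //; last by rewrite subr_gt0 exprn_egt1.
by rewrite subr_gt0 ltr_sqr// nnegrE ltW// (lt_trans s0).
Qed.

Lemma tangent_weight_gt0 s : s \in `]1, t[ -> 0 < tangent_weight k t s.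
Proof.
move=> /itv_sub[s0 ts s1].
have rad0 : 0 < rad_sq t by rewrite divr_gt0// subr_gt0 exprn_egt1.
by rewrite /tangent_weight /tangent_exponent !mulr_gt0// powR_gt0.
Qed.

Lemma measurable_tangent_exponent :
  measurable_fun setT (fun s => tangent_exponent k s t).
Proof.
apply: measurable_funM; apply: (measurableT_comp (measurable_powR _));
  by apply: measurable_funB => //; exact: measurable_funX.
Qed.

Lemma measurable_tangent_weight : measurable_fun setT (tangent_weight k t).
Proof.
apply: measurable_funM => //; apply: measurable_funM => //.
exact: measurable_tangent_exponent.
Qed.

Lemma ge0_integral_tangent_dist (phi : R -> \bar R) :
  measurable_fun setT phi -> (forall s, 0 <= phi s)%E ->
  (\int[surface_measure xi]_th phi (tangent_dist th) =
  (sphere_area R k.-1)%:E * \int[mu]_(s in `]1%R, t[) (phi s * (tangent_weight k t s)%:E))%E.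
Proof.
move=> mphi phi0; rewrite ge0_integral_surface//; last first.
  by apply: (measurableT_comp mphi); exact: measurable_tangent_dist.
have [BB _] := orthonormal_frameP xi.
have [e xE] := orthonormal_frame_span x_xi.
have xe : enorm x = enorm e by rewrite xE enorm_mul_orthonormal.
rewrite /tangent_dist xe {1}xE.
by rewrite (ge0_integral_tangent_cone dim_xi BB)// -xe.
Qed.

Let sphere_area_ge0 : 0 <= sphere_area R k.-1.
Proof.
case: k dim_xi => [//|[//|m]] _ /=.
by rewrite sphere_area_ball_volume mulr_ge0// fine_ge0// measure_ge0.
Qed.

Let weighted (h : R -> R) (s : R) : \bar R := (h s * tangent_weight k t s)%:E.

Lemma integrable_tangent_dist (h : R -> R) : measurable_fun setT h ->
  mu.-integrable `]1%R, t[ (weighted h) ->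
  (surface_measure xi).-integrable setT (fun th => (h (tangent_dist th))%:E).
Proof.
move=> mh /integrableP[_ ih]; apply/integrableP; split.
  by apply/measurable_EFinP; apply: (measurableT_comp mh); exact: measurable_tangent_dist.
rewrite (@ge0_integral_tangent_dist (fun s => `|(h s)%:E|%E))//; last first.
  by apply: measurableT_comp => //; exact/measurable_EFinP.
apply: lte_mul_pinfty => //; rewrite ?lee_fin//.
apply: le_lt_trans ih; rewrite le_eqVlt; apply/orP; left; apply/eqP.
apply: eq_integral => s; rewrite inE/= => sI.
have w0 := tangent_weight_gt0 sI.
by rewrite /weighted /= normrM (gtr0_norm w0) EFinM.
Qed.

(** The weight is positive on ]1, t[, so it commutes with taking positive and negative parts;
    integrability makes the negative part finite and the subtraction legitimate. *)
Lemma integral_tangent_dist (h : R -> R) : measurable_fun setT h ->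
  mu.-integrable `]1%R, t[ (weighted h) ->
  (\int[surface_measure xi]_th (h (tangent_dist th))%:E =
   (sphere_area R k.-1)%:E * \int[mu]_(s in `]1%R, t[) weighted h s)%E.
Proof.
move=> mh ih; rewrite integralE [in RHS]integralE.
have eqp : (\int[mu]_(s in `]1%R, t[) (weighted h)^\+ s =
   \int[mu]_(s in `]1%R, t[) ((EFin \o h)^\+ s * (tangent_weight k t s)%:E))%E.
  apply: eq_integral => s; rewrite inE/= => /tangent_weight_gt0 w0.
  by rewrite /weighted !funeposE EFinM maxe_pMl ?mul0e ?lee_fin ?(ltW w0)//.
have eqn : (\int[mu]_(s in `]1%R, t[) (weighted h)^\- s =
   \int[mu]_(s in `]1%R, t[) ((EFin \o h)^\- s * (tangent_weight k t s)%:E))%E.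
  apply: eq_integral => s; rewrite inE/= => /tangent_weight_gt0 w0.
  by rewrite /weighted !funenegE EFinM -mulNe maxe_pMl ?mul0e ?lee_fin ?(ltW w0)//.
have pos : (\int[surface_measure xi]_th (fun th => (h (tangent_dist th))%:E)^\+ th =
  (sphere_area R k.-1)%:E * \int[mu]_(s in `]1%R, t[) (weighted h)^\+ s)%E.
  rewrite eqp -ge0_integral_tangent_dist; last 2 first.
  - by apply: measurable_funepos; exact/measurable_EFinP.
  - by [].
  by apply: eq_integral => th _; rewrite !funeposE.
have neg : (\int[surface_measure xi]_th (fun th => (h (tangent_dist th))%:E)^\- th =
  (sphere_area R k.-1)%:E * \int[mu]_(s in `]1%R, t[) (weighted h)^\- s)%E.
  rewrite eqn -ge0_integral_tangent_dist; last 2 first.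
  - by apply: measurable_funeneg; exact/measurable_EFinP.
  - by [].
  by apply: eq_integral => th _; rewrite !funenegE.
have neg_fin : (\int[mu]_(s in `]1%R, t[) (weighted h)^\- s)%E \is a fin_num.
  exact: integrable_neg_fin_num.
rewrite pos neg [RHS]muleBr; first by [].
- by [].
- by rewrite fin_num_adde_defl// fin_numN.
Qed.

(** The nonnegative formula is applied to an indicator that vanishes almost everywhere on ]1,
    t[. The complement of ]1, t[ accounts for the directions $\mp x/|x|$, at distances 1 and $t$;
    the first is the point of tangency with the unit sphere. *)
Lemma surface_measure_tangent_dist0 (N : set R) : measurable N -> mu N = 0%E ->
  surface_measure xi (tangent_dist @^-1` (~` `]1, t[ `|` N)) = 0%E.
Proof.
move=> mN N0; set A := ~` _ `|` N.
have mA : measurable A by apply: measurableU => //; exact: measurableC.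
have mY : measurable (tangent_dist @^-1` A).
  by rewrite -[X in measurable X]setTI; exact: measurable_tangent_dist.
rewrite -[X in surface_measure xi X]setIT -integral_indic//.
transitivity (\int[surface_measure xi]_th (\1_A (tangent_dist th))%:E)%E; first by [].
rewrite (@ge0_integral_tangent_dist (fun s => (\1_A s)%:E))//; last first.
  by apply/measurable_EFinP; exact: measurable_indic.
rewrite (_ : integral _ _ _ = 0)%E ?mule0//.
have mw : measurable_fun `]1%R, t[ (fun s => ((\1_A s)%:E * (tangent_weight k t s)%:E)%E).
  apply: emeasurable_funM; apply/measurable_EFinP; apply: measurable_funTS.
    exact: measurable_indic.
  exact: measurable_tangent_weight.
transitivity (\int[mu]_(s in `]1%R, t[) (cst 0 s))%E; last exact: integral0.
apply: ae_eq_integral => //.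
exists N; split => // s /= /not_implyP[sI]; apply: contra_notP => sN.
by rewrite indicE memNset ?mul0e// => -[].
Qed.

End tangent_mean_formula.

(** * Borel versions and the completed measures *)

Lemma F_minus_borel (R : realType) (k : nat) (f0 : R -> R) (t : R) :
  let H s := F_integrand k (fun s => f0 s * (s ^+ 2 - 1) `^ ((k%:R - 3) / 2)) t s in
  (@completed_lebesgue_measure R).-integrable `]1%R, t[ (fun s => (H s)%:E) ->
  exists (g : R -> R) (N : set R), [/\ measurable_fun setT g, measurable N &
    lebesgue_measure N = 0%E] /\
    [/\ forall s, s \in `]1, t[ -> ~ N s -> H s = g s,
    (@lebesgue_measure R).-integrable `]1%R, t[ (EFin \o g) &
    (\int[completed_lebesgue_measure]_(s in `]1%R, t[) (H s)%:E =
     \int[lebesgue_measure]_(s in `]1%R, t[) (g s)%:E)%E].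
Proof.
move=> H iH; have /integrableP[mH _] := iH.
have [g [N [mg mN N0 Hg]]] := borel_version (measurable_itv `]1, t[)
  ((measurable_EFinP _ _).1 mH).
pose T' := caratheodory_type ((wlength (@idfun R))^*)%mu.
have mid : measurable_fun setT (idfun : T' -> measurableTypeR R).
  by move=> _ A mA; rewrite setTI; exact: sub_caratheodory.
have mE A : measurable A -> completed_lebesgue_measure ((idfun : T' -> measurableTypeR R) @^-1` A) =
  lebesgue_measure A by [].
have mge : measurable_fun setT (EFin \o g) by exact/measurable_EFinP.
have HgE s : `]1, t[%classic s -> ~ N s -> (H s)%:E = (EFin \o g) s.
  by move=> sI Ns /=; rewrite Hg.
have ig : (@lebesgue_measure R).-integrable `]1%R, t[ (EFin \o g).
  apply/(completion_integrable mid mE completed_lebesgue_measure_is_complete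
    (measurable_itv `]1, t[) mN N0 mge HgE); exact: iH.
exists g, N; split; first by split.
split; [exact: Hg|exact: ig|].
exact: (completion_integral mid mE completed_lebesgue_measure_is_complete
    (measurable_itv `]1, t[) mN N0 mge HgE ig).
Qed.

Lemma completed_surface_integral (R : realType) (n : nat)
    (xi : {vspace 'rV[R]_n}) (f g : 'rV[R]_n -> R) (N : set 'rV[R]_n) :
  measurable N -> surface_measure xi N = 0%E -> measurable_fun setT g ->
  (forall th, ~ N th -> f th = g th) ->
  (surface_measure xi).-integrable setT (EFin \o g) ->
  (completed_surface_measure xi).-integrable (unit_sphere xi) (EFin \o f) /\
  (\int[completed_surface_measure xi]_(th in unit_sphere xi) (f th)%:E =
   \int[surface_measure xi]_th (g th)%:E)%E.
Proof.
move=> mN N0 mg fg ig.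
have mS := measurable_unit_sphere xi.
have igS : (surface_measure xi).-integrable (unit_sphere xi) (EFin \o g).
  exact: (integrableS measurableT mS _ ig).
pose T' := caratheodory_type ((surface_measure xi)^*)%mu.
have mid : measurable_fun setT (idfun : T' -> 'rV[R]_n).
  by move=> _ A mA; rewrite setTI; exact: caratheodory_measurable_mu_ext.
have mE A : measurable A -> completed_surface_measure xi ((idfun : T' -> 'rV[R]_n) @^-1` A) =
  surface_measure xi A by move=> mA; exact: measurable_mu_extE.
have mge : measurable_fun setT (EFin \o g) by exact/measurable_EFinP.
have cm : measure_is_complete (completed_surface_measure xi).
  exact: measure_is_complete_caratheodory.
have fgE th : unit_sphere xi th -> ~ N th -> (f th)%:E = (EFin \o g) th.
  by move=> _ Nth /=; rewrite fg.
split.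
  by apply/(completion_integrable mid mE cm mS mN N0 mge fgE).
rewrite (completion_integral mid mE cm mS mN N0 mge fgE igS).
rewrite [RHS](negligible_integral (measurableC mS) measurableT ig).
  by rewrite setDE setCK setTI.
exact: surface_measure_unit_sphereC.
Qed.

Theorem lemma3p12 (R : realType) (n k : nat) (hkn : (2 <= k <= n)%N)
    (f : 'rV[R]_n -> R) (f0 : R -> R)
    (mf : lebesgue_measurable_fun [set y : 'rV[R]_n | 1 < enorm y] f)
    (radial_f : forall y : 'rV[R]_n, 1 < enorm y -> f y = f0 (enorm y))
    (x : 'rV[R]_n) (hx : 1 < enorm x)
    (xi : {vspace 'rV[R]_n}) (hxi : Grass_through k x xi) :
  let f1 := fun s : R => f0 s * (s ^+ 2 - 1) `^ ((k%:R - 3) / 2) in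
  let t := 2 * enorm x - 1 in
  F_minus_exists k f1 t ->
  Q_minus_exists f x xi /\ Q_minus f x xi = Phi_minus k f1 t.
Proof.
case: hxi => dxi xxi f1 t hF.
have k2 : (2 <= \dim xi)%N by rewrite dxi; case/andP: hkn.
have t1 : 1 < t by rewrite /t; lra.
have [g [N [[mg mN N0] [Hg ig Hint]]]] := F_minus_borel hF.
(* The integrand of $F_-$ is $f_0$ times [E]. As [E] is positive on ]1, t[, dividing the Borel
   version [g] of that integrand by [E] gives a Borel version [h] of $f_0$ there. *)
pose E s := tangent_exponent k s t * s.
have E_gt0 s : s \in `]1, t[ -> 0 < E s.
  rewrite in_itv/= => /andP[s1 st]; have s0 : 0 < s by rewrite (lt_trans ltr01).
  rewrite /E /tangent_exponent !mulr_gt0// powR_gt0// subr_gt0 ?exprn_egt1//.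
  by rewrite ltr_sqr// nnegrE ltW// (lt_trans s0).
have mE : measurable_fun setT (fun s => g s / E s).
  apply: measurable_funM => //; apply: (measurableT_comp (@measurable_inv R)).
  apply: measurable_funM => //; rewrite /E -dxi.
  exact: (@measurable_tangent_exponent R n xi x).
pose h s := g s / E s.
(* [tangent_weight] is [C] times [E], so [E] cancels and the weighted [h] is [C] times [g]. *)
pose C := 2 * rad_sq t `^ (2 - k%:R).
have hW s : s \in `]1, t[ -> h s * tangent_weight (\dim xi) t s = C * g s.
  move=> sI; rewrite /h dxi /tangent_weight -/(E s) -/C; field.
  by rewrite gt_eqF// E_gt0.
have ihW : (@lebesgue_measure R).-integrable `]1, t[
    (fun s => (h s * tangent_weight (\dim xi) t s)%:E).
  apply: (@eq_integrable _ (measurableTypeR R) R lebesgue_measure `]1, t[%classic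
    (measurable_itv _) (fun s => (C%:E * (EFin \o g) s)%E)).
    by move=> s; rewrite inE => sI; rewrite hW// EFinM.
  exact: integrableZl.
pose A := ~` `]1, t[%classic `|` N.
have fh th : ~ (tangent_dist x @^-1` A) th -> Q_integrand f x th = h (tangent_dist x th).
  rewrite /A /= => /not_orP[/contrapT sI Ns].
  rewrite /Q_integrand radial_f; last first.
    by move: sI; rewrite /= in_itv/= => /andP[].
  rewrite -/(tangent_dist x th) /h -(Hg _ sI Ns) /F_integrand.
  apply: (mulIf (x := E (tangent_dist x th))); first by rewrite gt_eqF ?E_gt0.
  rewrite divfK ?gt_eqF ?E_gt0// /E /tangent_exponent; ring.
have mA : measurable (tangent_dist x @^-1` A).
  rewrite -[X in measurable X]setTI; apply: measurable_tangent_dist => //.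
  by apply: measurableU => //; exact: measurableC.
have mhY : measurable_fun setT (fun th => h (tangent_dist x th)).
  by apply: (measurableT_comp mE); exact: measurable_tangent_dist.
have ihY := integrable_tangent_dist k2 xxi hx mE ihW.
have [iQ QE] := completed_surface_integral mA
  (surface_measure_tangent_dist0 k2 xxi hx mN N0) mhY fh ihY.
split; first exact: iQ.
rewrite /Q_minus /Phi_minus /F_minus /Rintegral QE Hint.
rewrite (integral_tangent_dist k2 xxi hx mE ihW).
have -> : (\int[lebesgue_measure]_(s in `]1%R, t[) (h s * tangent_weight (\dim xi) t s)%:E =
    C%:E * \int[lebesgue_measure]_(s in `]1%R, t[) (g s)%:E)%E.
  rewrite -integralZl//; apply: eq_integral => s; rewrite inE => sI.
  by rewrite hW// EFinM.
have /fineK <- : (\int[lebesgue_measure]_(s in `]1%R, t[) (g s)%:E)%E \is a fin_num.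
  exact: integrable_fin_num ig.
rewrite -!EFinM /= /C /rad_sq dxi; set I := fine _.
have k0 : (0 < k)%N by rewrite -dxi; exact: leq_trans k2.
have kE : k.-1%:R = k%:R - 1 :> R by rewrite -{2}(prednK k0) -natr1 addrK.
rewrite /sphere_area kE invf_div.
(* Splitting this power leaves the single factor $\pi^{1/2}$ in the quotient of the two sphere
   areas. *)
have -> : pi `^ (k%:R / 2) = pi `^ ((k%:R - 1) / 2) * pi `^ (1 / 2) :> R.
  rewrite -powRD; first by congr powR; field.
  by rewrite (gt_eqF (pi_gt0 R)) implybT.
have p1 : pi `^ ((k%:R - 1) / 2) != 0 :> R by rewrite gt_eqF// powR_gt0// pi_gt0.
have p2 : pi `^ (1 / 2) != 0 :> R by rewrite gt_eqF// powR_gt0// pi_gt0.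
move: (Gamma (k%:R / 2)) (Gamma ((k%:R - 1) / 2)) => G1 G2.
(* Both sides are linear in the inverse of [G2], which is therefore treated as an atom. *)
by move: (G2^-1) => G2'; field; rewrite p1 p2.
Qed.
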